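(* The $\alpha$-warped Segre--Veronese manifold $\mathcal{S}_\alpha^{\mathbf{k}}$ is geodesically connected if $0 < \alpha < 1 / \sqrt{k_1 + \dots + k_d}$, and is not geodesically connected if $2 / \sqrt{k_1 + \dots + k_d} \leq \alpha$.
   Context: Let $d\ge 1$, let $n_1,\dots,n_d\ge 2$ and $k_1,\dots,k_d\ge1$ be integers, $\mathbf{k}=(k_1,\dots,k_d)$, and $\alpha>0$. $\mathbb{S}^{n-1}\subset\mathbb{R}^n$ is the unit sphere and $\langle\cdot,\cdot\rangle$ the Euclidean inner product. The $\alpha$-warped Segre--Veronese manifold $\mathcal{S}_\alpha^{\mathbf{k}}$ is the submanifold $\{\lambda\mathbf{u}_1^{\otimes k_1}\otimes\cdots\otimes\mathbf{u}_d^{\otimes k_d}\mid\lambda>0,\ \mathbf{u}_i\in\mathbb{S}^{n_i-1}\}$ of $\mathbb{R}^{n_1^{k_1}\times\cdots\times n_d^{k_d}}\setminus\{0\}$, with the Riemannian metric induced from the ambient metric $\varsigma^\alpha_{\lambda \mathcal{W}}(\dot{x}\,\mathcal{W}+\lambda\dot{\mathcal{V}},\dot{y}\,\mathcal{W}+\lambda\dot{\mathcal{V}}')=\dot{x}\dot{y}+(\alpha\lambda)^2\langle\dot{\mathcal{V}},\dot{\mathcal{V}}'\rangle$, where $\lambda>0$, $\|\mathcal{W}\|=1$, and $\dot{\mathcal{V}},\dot{\mathcal{V}}'\perp\mathcal{W}$ ($\alpha=1$ gives the Euclidean metric). A Riemannian manifold is called geodesically connected here if every pair of its points can be connected by a minimizing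 geodesic, i.e., by a piecewise smooth curve in the manifold whose length equals the intrinsic distance (infimum of lengths of piecewise smooth curves) between the points. *)

(* Defs.v *)
From HB Require Import structures.
From mathcomp Require Import all_boot all_order all_algebra.
From mathcomp Require Import all_classical all_reals all_analysis.

Set Implicit Arguments.
Unset Strict Implicit.
Unset Printing Implicit Defensive.

Import Order.TTheory GRing.Theory Num.Theory.
Import numFieldNormedType.Exports.

Local Open Scope classical_set_scope.
Local Open Scope ring_scope.

(* Euclidean space with coordinates indexed by a finite type is
   {ffun I -> R}. *)
Section Euclidean.
Context {R : realType} {I : finType}.
Implicit Types x y : {ffun I -> R}.

Definition dot x y : R := \sum_i x i * y i.

Definition enorm x : R := Num.sqrt (dot x x).

End Euclidean.

Section Curves.
Context {R : realType} {I : finType}.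
Local Notation E := {ffun I -> R}.
Implicit Types (M : set E) (g : E -> E -> E -> R) (c : R -> E) (p q : E).

Definition smooth (f : R -> R) : Prop :=
  forall (m : nat) (t : R), derivable (f^`(m))%classic t 1.

(* Smoothness on the closed interval [s, t], endpoints included: being the
   restriction of a smooth curve of the ambient space.  Nothing is required
   of c outside [s, t]. *)
Definition smooth_on (s t : R) c : Prop :=
  exists c' : R -> E,
    (forall i, smooth (fun u => c' u i)) /\ {in `[s, t], c =1 c'}.

(* Consecutive pieces overlap at the breakpoints, so c is continuous on
   [a, b]. *)
Definition piecewise_smooth (a b : R) c : Prop :=
  exists ts : seq R, itv_partition a b ts /\
    forall j, (j < size ts)%N ->
      smooth_on (nth b (a :: ts) j) (nth b (a :: ts) j.+1) c.

Definition velocity c (t : R) : E :=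
  [ffun i => ((fun s => c s i)^`())%classic t].

(* The velocity takes unspecified values at the endpoints and breakpoints of a
   piecewise smooth curve; they do not affect the integral. *)
Definition curve_length g (a b : R) c : \bar R :=
  (\int[lebesgue_measure]_(t in `[a, b])
     (Num.sqrt (g (c t) (velocity c t) (velocity c t)))%:E)%E.

Definition curve_from_to M p q (a b : R) c : Prop :=
  [/\ a < b, piecewise_smooth a b c, {in `[a, b], forall t, M (c t)},
      c a = p & c b = q].

Definition intrinsic_dist M g p q : \bar R :=
  ereal_inf [set L | exists a b c,
    curve_from_to M p q a b c /\ L = curve_length g a b c].

Definition geodesically_connected M g : Prop :=
  forall p q, M p -> M q ->
    exists a b c, curve_from_to M p q a b c /\
      curve_length g a b c = intrinsic_dist M g p q.

End Curves.

Section WarpedMetric.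
Context {R : realType} {I : finType}.
Local Notation E := {ffun I -> R}.
Implicit Types (alpha : R) (p v w : E).

(* At p = l W with l = |p| > 0 and |W| = 1, a vector v is uniquely
   x W + l V with V orthogonal to W; here x is [radial p v] and V is
   [angular p v].  See [warped_metricE]. *)
Definition direction p : E := (enorm p)^-1 *: p.

Definition radial p v : R := dot v (direction p).

Definition angular p v : E := (enorm p)^-1 *: (v - radial p v *: direction p).

Definition warped_metric alpha p v w : R :=
  radial p v * radial p w
  + (alpha * enorm p) ^+ 2 * dot (angular p v) (angular p w).

Lemma dotC v w : dot v w = dot w v.
Proof. by apply: eq_bigr => i _; rewrite mulrC. Qed.

Lemma dotDl p v w : dot (p + v) w = dot p w + dot v w.
Proof. by rewrite -big_split; apply: eq_bigr => i _; rewrite ffunE mulrDl. Qed.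

Lemma dotZl (x : R) v w : dot (x *: v) w = x * dot v w.
Proof.
rewrite [RHS]mulr_sumr.
by apply: eq_bigr => i _; rewrite ffunE -mulrA.
Qed.

Lemma warped_metricE alpha (l x y : R) (W V V' : E) :
  0 < l -> enorm W = 1 -> dot V W = 0 -> dot V' W = 0 ->
  warped_metric alpha (l *: W) (x *: W + l *: V) (y *: W + l *: V') =
  x * y + (alpha * l) ^+ 2 * dot V V'.
Proof.
move=> l0 W1 VW V'W.
have WW : dot W W = 1.
  have ge0 : 0 <= dot W W by apply: sumr_ge0 => i _; rewrite -expr2 sqr_ge0.
  by rewrite -(sqr_sqrtr ge0) -/(enorm W) W1 expr1n.
have nlW : enorm (l *: W) = l.
  by rewrite /enorm dotZl dotC dotZl WW mulr1 -expr2 sqrtr_sqr gtr0_norm.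
have dirE : direction (l *: W) = W.
  by rewrite /direction nlW scalerA mulVf ?scale1r ?gt_eqF.
have radE z U : dot U W = 0 -> radial (l *: W) (z *: W + l *: U) = z.
  by move=> UW; rewrite /radial dirE dotDl !dotZl WW UW mulr1 mulr0 addr0.
have angE z U : dot U W = 0 -> angular (l *: W) (z *: W + l *: U) = U.
  move=> UW; rewrite /angular radE // dirE addrAC subrr add0r nlW.
  by rewrite scalerA mulVf ?scale1r ?gt_eqF.
by rewrite /warped_metric !radE // !angE // nlW.
Qed.

End WarpedMetric.

Section SegreVeronese.
Context {R : realType} {d : nat}.
Implicit Types n k : 'I_d -> nat.

(* A multi-index has, for each i < d, a block of k i indices below n i, so
   that {ffun multi_index n k -> R} is R^(n_1^k_1 x ... x n_d^k_d). *)
Definition multi_index n k : finType :=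
  {dffun forall i : 'I_d, {ffun 'I_(k i) -> 'I_(n i)}}.

Definition rank_one n k (u : forall i, {ffun 'I_(n i) -> R}) :
    {ffun multi_index n k -> R} :=
  [ffun J : multi_index n k => \prod_(i < d) \prod_(l < k i) u i (J i l)].

Definition segre_veronese n k : set {ffun multi_index n k -> R} :=
  [set p | exists (l : R) (u : forall i, {ffun 'I_(n i) -> R}),
    [/\ 0 < l, forall i, enorm (u i) = 1 & p = l *: rank_one k u]].

End SegreVeronese.

(* Main.v *)
Require Import Defs.
From mathcomp Require Import all_boot all_order all_algebra.
From mathcomp Require Import all_classical all_reals all_analysis.
From mathcomp Require Import measurable_realfun ring lra.

(** The manifold is a cone. At [p = l *: W] with [l = |p|] and [|W| = 1], the
   metric is [dl ^ 2 + (alpha l) ^ 2 |dW| ^ 2], and the unit tensors [W] of rank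
   one form the product of the spheres of radii [sqrt (k i)], modulo the changes
   of signs of the factors that do not change the tensor. Let [phi] be the
   angle of [p] and [q], i.e. the distance of their directions in this quotient.
   Unrolling the cone maps a curve from [p] to [q] to a curve of the plane that
   has the same length and turns around the origin by at least [alpha * phi].
   If [alpha * phi < pi], the shortest possibility is a straight segment, and it
   is realized above a geodesic of the product of spheres. If
   [alpha * phi >= pi], the infimum is [|p| + |q|], for the path through the
   origin; the origin is not in the manifold, so the infimum is not attained.

   Since [phi ^ 2 = \sum_i k i * t i ^ 2] with angles [t i <= pi], it holds that
   [phi <= pi * sqrt (\sum_i k i)], so that [alpha * phi < pi] for all pairs of
   points when [alpha < 1 / sqrt (\sum_i k i)]. If the factors of [p] and [q]
   are orthogonal, the changes of signs have no effect on the [t i = pi / 2] and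
   [phi = pi / 2 * sqrt (\sum_i k i)], whence [alpha * phi >= pi] as soon as
   [alpha >= 2 / sqrt (\sum_i k i)].

   The bound from below for all curves is obtained without lifting them to the
   product of spheres. For unit tensors [V] and [W] with [<V, W> > 0], the
   angle to a fixed point changes by at most [sqrt (1 / <V, W> ^ 2 - 1)] between
   [V] and [W] ([angle_lipschitz]); this combines the triangle inequality on the
   spheres with [t <= tan t]. Represent each [y] in the manifold by the point of
   the plane with polar coordinates [|y|] and [alpha] times the angle of [y] and
   [p], truncated at [pi]. A linear coordinate of this point changes by at most
   the square root of [sqr_chord] ([dev_coord_chord]), which
   to first order is the speed of the curve times the change of the parameter
   ([chord_speed]). A mean value inequality for one-sided difference quotients
   ([right_quotient_le]) then bounds the change of the coordinate by the length
   ([length_lower_bound]). A suitable choice of the coordinate gives the length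
   of a planar segment.

   The competitors are the curves [helix], which unroll to straight lines with a
   suitably chosen ratio between the angle in the product of spheres and the
   angle in the plane. For any other ratio they stay short when they pass close
   to the origin, which is how the infimum [|p| + |q|] is approached
   ([far_dist]); that every curve is strictly longer is [far_length]. *)

Set Implicit Arguments.
Unset Strict Implicit.
Unset Printing Implicit Defensive.

Import Order.TTheory GRing.Theory Num.Theory.
Import numFieldNormedType.Exports.
Local Open Scope classical_set_scope.
Local Open Scope ring_scope.

(** * Elementary inequalities *)

Section Trigonometry.
Context {R : realType}.
Implicit Types x y a b l m : R.

Lemma sin_le x : 0 <= x -> sin x <= x.
Proof.
move=> x0.
have [|c _] := @MVT_segment R sin cos 0 x x0 (fun z _ => is_derive_sin z).
  by apply: continuous_subspaceT => z; exact: continuous_sin.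
rewrite sin0 !subr0 => ->.
by rewrite -[leRHS]mul1r ler_wpM2r// cos_le1.
Qed.

Lemma sqr_sin_le x : sin x ^+ 2 <= x ^+ 2.
Proof.
wlog x0 : x / 0 <= x => [h|].
  by case: (leP 0 x) => [/h//|xn]; rewrite -sqrrN -sinN -[leRHS]sqrrN h// oppr_ge0 ltW.
have h1 := sin_le x0.
have [x1|x1] := leP x 1; last first.
  rewrite (@le_trans _ _ 1)// ?sin2cos2 ?gerBl ?sqr_ge0//.
  by rewrite -[leLHS](expr1n _ 2) lerXn2r ?nnegrE// ltW.
rewrite lerXn2r ?nnegrE//; apply: sin_ge0_pi; rewrite x0/=.
by rewrite (le_trans x1)// (le_trans _ (pi_ge2 R))// ler1n.
Qed.

Lemma cos_ge_parabola x : 1 - x ^+ 2 / 2 <= cos x.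
Proof.
have -> : cos x = 1 - sin (x / 2) ^+ 2 *+ 2.
  have {1}-> : x = (x / 2) *+ 2 by rewrite -mulr_natr divfK.
  by rewrite cos_mulr2n cos2sin2; ring.
have := sqr_sin_le (x / 2).
have -> : (x / 2) ^+ 2 = x ^+ 2 / 4 by field.
lra.
Qed.

Lemma atan_le x : 0 <= x -> atan x <= x.
Proof.
move=> x0.
have [|c _] := @MVT_segment R atan _ 0 x x0 (fun z _ => is_derive1_atan z).
  by apply: continuous_subspaceT => z; exact: continuous_atan.
rewrite atan0 !subr0 => ->.
rewrite -[leRHS]mul1r ler_wpM2r// invf_le1 ?lerDl ?sqr_ge0//.
by rewrite ltr_pwDl// sqr_ge0.
Qed.

(** This is [t <= tan t] for [t = acos x]; written with [1 / cos t ^ 2], it can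
   be multiplied over the factors of a product of spheres. *)
Lemma sqr_acos_le x : 0 < x <= 1 -> 1 + acos x ^+ 2 <= x ^- 2.
Proof.
move=> /andP[x0 x1].
have x11 : x \in `[(-1), 1] by rewrite in_itv/= x1 andbT ltW// (lt_trans _ x0)// ltrN10.
have x11' : -1 <= x <= 1 by move: x11; rewrite in_itv.
have a0 := acos_ge0 x11'.
have cE := acosK x11.
have aph : acos x < pi / 2.
  rewrite ltNge; apply/negP => h.
  suff : cos (acos x) <= cos (pi / 2) by rewrite cE cos_pihalf leNgt x0.
  have p0 := pi_gt0 R.
  rewrite leNgt; apply/negP; rewrite ltr_cos ?in_itv/= ?a0 ?acos_lepi//.
    by rewrite ltNge h.
  apply/andP; split; lra.
have c0 : cos (acos x) != 0 by rewrite cE gt_eqF.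
rewrite -{2}cE cos2_tan2// lerD2l lerXn2r// ?nnegrE//.
- by rewrite /tan sin_acos// divr_ge0 ?sqrtr_ge0// cE ltW.
- have t0 : 0 <= tan (acos x).
    by rewrite /tan sin_acos// divr_ge0 ?sqrtr_ge0// cE ltW.
  apply: le_trans (atan_le t0); rewrite tanK// in_itv/= aph andbT.
  by rewrite (lt_le_trans _ a0)// oppr_lt0 divr_gt0// pi_gt0.
Qed.

Lemma acos_le_of_cos a x : 0 <= a -> -1 <= x <= 1 -> cos a <= x -> acos x <= a.
Proof.
move=> a0 x1 cax.
have [api|api] := leP a pi; last by rewrite (le_trans (acos_lepi x1))// ltW.
rewrite leNgt; apply/negP => h.
have : cos (acos x) < cos a.
  by rewrite ltr_cos// in_itv/= ?a0 ?api// acos_ge0// acos_lepi.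
by rewrite acosK ?in_itv//= ltNge cax.
Qed.

(** The points of the plane with polar coordinates [(l, a)] and [(m, b)] have
   squared distance [(l - m) ^ 2 + 2 * l * m * (1 - cos (a - b))], and their
   second coordinates differ by no more. *)
Lemma polar_sin_lipschitz l m a b : 0 <= l -> 0 <= m ->
  (l * sin a - m * sin b) ^+ 2 <= (l - m) ^+ 2 + l * m * (a - b) ^+ 2.
Proof.
move=> l0 m0.
have h : l * m * (1 - (a - b) ^+ 2 / 2) <= l * m * cos (a - b).
  by rewrite ler_wpM2l ?mulr_ge0// cos_ge_parabola.
have e : (l * sin a - m * sin b) ^+ 2 + (l * cos a - m * cos b) ^+ 2
       = l ^+ 2 + m ^+ 2 - 2 * (l * m * cos (a - b)).
  rewrite cosB.
  transitivity (l ^+ 2 * (cos a ^+ 2 + sin a ^+ 2)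
     + m ^+ 2 * (cos b ^+ 2 + sin b ^+ 2)
     - 2 * (l * m * (cos a * cos b + sin a * sin b))); first by ring.
  by rewrite !cos2Dsin2 !mulr1.
have := sqr_ge0 (l * cos a - m * cos b).
nra.
Qed.

Lemma ler_sqrt_of_sqr x y : x ^+ 2 <= y -> x <= Num.sqrt y.
Proof.
move=> h; apply: le_trans (ler_norm x) _.
by rewrite -sqrtr_sqr ler_wsqrtr.
Qed.

End Trigonometry.

Lemma min_lipschitz (R : realDomainType) (m a b : R) :
  (Num.min m a - Num.min m b) ^+ 2 <= (a - b) ^+ 2.
Proof.
wlog ab : a b / a <= b => [h|].
  by case: (leP a b) => [/h//|/ltW/h]; rewrite -sqrrN opprB -[leRHS]sqrrN opprB.
rewrite -sqrrN opprB -[leRHS]sqrrN opprB lerXn2r// ?nnegrE ?subr_ge0//.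
  by rewrite /Num.min; case: ltP => h1; case: ltP => h2; lra.
rewrite /Num.min; case: ltP => h1; case: ltP => h2; lra.
Qed.

Lemma bernoulli_prod (R : realFieldType) (I : finType) (a : I -> R) (k : I -> nat) :
  (forall i, 0 <= a i) ->
  1 + \sum_i (k i)%:R * a i <= \prod_i (1 + a i) ^+ k i.
Proof.
move=> a0.
(* The sum has to be known to be nonnegative in order to drop the cross terms. *)
suff /andP[] : (0 <= \sum_i (k i)%:R * a i) &&
  (1 + \sum_i (k i)%:R * a i <= \prod_i (1 + a i) ^+ k i) by [].
elim/big_rec2 : _ => [|i y2 y1 _ /andP[y20 y12]]; first by rewrite addr0 !lexx.
have ka0 : 0 <= (k i)%:R * a i by rewrite mulr_ge0.
rewrite addr_ge0//=.
have b : 1 + (k i)%:R * a i <= (1 + a i) ^+ k i.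
  elim: (k i) => [|m IH]; first by rewrite mul0r addr0.
  have := ler_wpM2r (addr_ge0 ler01 (a0 i)) IH; rewrite -exprSr; apply: le_trans.
  rewrite -natr1 mulrDl mul1r.
  have := mulr_ge0 (mulr_ge0 (ler0n R m) (a0 i)) (a0 i).
  move: (m%:R * a i) (a i) => A B; lra.
apply: (@le_trans _ _ ((1 + (k i)%:R * a i) * (1 + y2))).
  by move: ((k i)%:R * a i) ka0 => A A0; have := mulr_ge0 A0 y20; lra.
by apply: ler_pM; rewrite ?addr_ge0.
Qed.

Lemma bernoulli_prod_sub (R : realFieldType) (I : finType) (a : I -> R) (k : I -> nat) :
  (forall i, 0 <= a i <= 1) ->
  1 - \sum_i (k i)%:R * a i <= \prod_i (1 - a i) ^+ k i.
Proof.
move=> a01.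
suff /and3P[] : [&& 0 <= \prod_i (1 - a i) ^+ k i,
  \prod_i (1 - a i) ^+ k i <= 1 &
  1 - \sum_i (k i)%:R * a i <= \prod_i (1 - a i) ^+ k i] by [].
elim/big_rec2 : _ => [|i P S _ /and3P[P0 P1 PS]].
  by rewrite subr0 lexx ler01.
have /andP[a0 a1] := a01 i.
have [b0 b1] : 0 <= 1 - a i /\ 1 - a i <= 1 by split; lra.
have c0 : 0 <= (1 - a i) ^+ k i by rewrite exprn_ge0.
have c1 : (1 - a i) ^+ k i <= 1 by rewrite exprn_ile1.
have b : 1 - (k i)%:R * a i <= (1 - a i) ^+ k i.
  elim: (k i) => [|m IH]; first by rewrite mul0r subr0.
  rewrite exprS -natr1; move: IH.
  have : 0 <= m%:R :> R by [].
  have : (1 - a i) ^+ m <= 1 by rewrite exprn_ile1.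
  move: (m%:R) ((1 - a i) ^+ m) => N Y Y1 N0 h.
  nra.
apply/and3P; split; first by rewrite mulr_ge0.
  by rewrite mulr_ile1.
move: ((k i)%:R * a i) ((1 - a i) ^+ k i) c0 c1 b => A C c0 c1 b.
nra.
Qed.

(** * Euclidean geometry *)

Section Dot.
Context {R : realType} {I : finType}.
Local Notation E := {ffun I -> R}.
Implicit Types u v w x y z : E.

Lemma dotDr x y z : dot x (y + z) = dot x y + dot x z.
Proof. by rewrite dotC dotDl !(dotC x). Qed.

Lemma dotZr (a : R) x y : dot x (a *: y) = a * dot x y.
Proof. by rewrite dotC dotZl dotC. Qed.

Lemma dotNl x y : dot (- x) y = - dot x y.
Proof. by rewrite -scaleN1r dotZl mulN1r. Qed.

Lemma dotNr x y : dot x (- y) = - dot x y.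
Proof. by rewrite dotC dotNl dotC. Qed.

Lemma dot0l x : dot 0 x = 0.
Proof. by rewrite -(scale0r (0 : E)) dotZl mul0r. Qed.

Lemma enorm0 : enorm (0 : E) = 0.
Proof. by rewrite /enorm dot0l sqrtr0. Qed.

Lemma dot_ge0 x : 0 <= dot x x.
Proof. by apply: sumr_ge0 => i _; rewrite -expr2 sqr_ge0. Qed.

Lemma enorm_ge0 x : 0 <= enorm x. Proof. exact: sqrtr_ge0. Qed.

Lemma sqr_enorm x : enorm x ^+ 2 = dot x x.
Proof. by rewrite sqr_sqrtr// dot_ge0. Qed.

Lemma dot_eq0 x : dot x x = 0 -> x = 0.
Proof.
move=> h; apply/ffunP => i; rewrite ffunE.
have /eqP : x i * x i = 0.
  by apply: (psumr_eq0P _ h) => // j _; rewrite -expr2 sqr_ge0.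
by rewrite mulf_eq0 orbb => /eqP.
Qed.

Lemma cauchy_schwarz x y : dot x y ^+ 2 <= dot x x * dot y y.
Proof.
have [y0|] := eqVneq (dot y y) 0.
  by rewrite (dot_eq0 y0) dotC !dot0l mulr0 expr0n.
move=> ny.
have yy : 0 < dot y y by rewrite lt_def ny dot_ge0.
have := dot_ge0 (dot y y *: x - dot x y *: y).
rewrite !(dotDl, dotDr, dotNl, dotNr, dotZl, dotZr) (dotC y x).
set X := dot x x; set Y := dot y y in yy *; set Z := dot x y.
rewrite (_ : _ + _ = Y * (X * Y - Z ^+ 2)); last by ring.
by rewrite pmulr_rge0// subr_ge0.
Qed.

Lemma dot_unit_bound u v : dot u u = 1 -> dot v v = 1 -> -1 <= dot u v <= 1.
Proof.
move=> u1 v1; rewrite -ler_norml -sqrtr_sqr -[leRHS]sqrtr1 ler_wsqrtr//.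
by have := cauchy_schwarz u v; rewrite u1 v1 mulr1.
Qed.

(** By the Cauchy-Schwarz inequality for the components of [u] and [w]
   orthogonal to [v], the cosine of the angle between [u] and [w] is at least
   the cosine of the sum of the two other angles. *)
Lemma acos_dot_triangle u v w : dot u u = 1 -> dot v v = 1 -> dot w w = 1 ->
  acos (dot u w) <= acos (dot u v) + acos (dot v w).
Proof.
move=> u1 v1 w1.
have uv := dot_unit_bound u1 v1; have vw := dot_unit_bound v1 w1.
have uw := dot_unit_bound u1 w1.
apply: acos_le_of_cos => //; first by rewrite addr_ge0// acos_ge0.
rewrite cosD !acosK ?in_itv// !sin_acos//.
have := cauchy_schwarz (- (u - dot u v *: v)) (w - dot v w *: v).
rewrite !(dotDl, dotDr, dotNl, dotNr, dotZl, dotZr) u1 v1 w1 (dotC v u) (dotC w v).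
set x := dot u v in uv *; set y := dot v w in vw *; set z := dot u w.
move=> h; rewrite -sqrtrM; last first.
  by move/andP: uv => [? ?]; nra.
rewrite lerBlDr -lerBlDl; apply: ler_sqrt_of_sqr.
rewrite -sqrrN.
by apply: le_trans (le_trans _ h) _; rewrite le_eqVlt; apply/orP; left; apply/eqP; ring.
Qed.
Lemma enorm_gt0 x : x != 0 -> 0 < enorm x.
Proof.
move=> x0; rewrite lt_def enorm_ge0 andbT; apply: contra x0 => /eqP x0.
by apply/eqP/dot_eq0; rewrite -sqr_enorm x0 expr0n.
Qed.

Lemma dot_gt0 (p : E) : p != 0 -> 0 < dot p p.
Proof. by move=> p0; rewrite -sqr_enorm exprn_gt0// enorm_gt0. Qed.

Lemma enorm_triangle x y : enorm (x + y) <= enorm x + enorm y.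
Proof.
rewrite -(@ler_pXn2r _ 2) ?nnegrE ?addr_ge0 ?enorm_ge0//.
rewrite sqrrD !sqr_enorm !(dotDl, dotDr) (dotC y x).
suff : dot x y <= enorm x * enorm y by lra.
rewrite /enorm -sqrtrM ?dot_ge0//; apply: ler_sqrt_of_sqr.
exact: cauchy_schwarz.
Qed.

Lemma enorm_le z x : (forall i, 0 <= z i <= x i) -> enorm z <= enorm x.
Proof.
move=> zx; rewrite /enorm ler_wsqrtr//; apply: ler_sum => i _.
by have /andP[z0 zxi] := zx i; apply: ler_pM.
Qed.

End Dot.

Section GreatCircle.
Context {R : realType} {m : nat}.
Local Notation E := {ffun 'I_m -> R}.
Implicit Types u v w : E.

Lemma unit_of_nonzero u y : y != 0 -> dot u y = 0 ->
  exists2 w, dot w w = 1 & dot u w = 0.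
Proof.
move=> y0 uy; have l0 := enorm_gt0 y0.
exists ((enorm y)^-1 *: y); last by rewrite dotZr uy mulr0.
by rewrite dotZl dotZr -sqr_enorm; field; rewrite gt_eqF.
Qed.

(** The components orthogonal to [u] of two vectors of the standard basis do not
   both vanish. *)
Lemma orthogonal_unit u : (2 <= m)%N -> dot u u = 1 ->
  exists2 w, dot w w = 1 & dot u w = 0.
Proof.
move=> m2 u1.
pose i0 : 'I_m := Ordinal (ltnW m2); pose i1 : 'I_m := Ordinal m2.
pose e (j : 'I_m) : E := [ffun i => (i == j)%:R].
have ue j : dot u (e j) = u j.
  rewrite /dot (bigD1 j)//= ffunE eqxx mulr1 big1 ?addr0// => i ij.
  by rewrite ffunE (negbTE ij) mulr0.
have orth j : dot u (e j - u j *: u) = 0.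
  by rewrite dotDr dotNr dotZr ue u1 mulr1 subrr.
have [e0|/unit_of_nonzero] := eqVneq (e i0 - u i0 *: u) 0; last exact.
have [e1|/unit_of_nonzero] := eqVneq (e i1 - u i1 *: u) 0; last exact.
have := congr1 (fun f : E => f i1) e0.
have := congr1 (fun f : E => f i0) e0.
have := congr1 (fun f : E => f i1) e1.
rewrite /= !ffunE /GRing.scale/= ?eqxx.
move=> h1 h0 /eqP; rewrite sub0r oppr_eq0 mulf_eq0 => /orP[/eqP u0|/eqP u0].
  by move: h0; rewrite u0 mul0r subr0 => /eqP; rewrite oner_eq0.
by move: h1; rewrite u0 mul0r subr0 => /eqP; rewrite oner_eq0.
Qed.

(** The initial velocity [w] of a great circle from [u] to [v] is the direction of
   the component of [v] orthogonal to [u]; if [v] is [u] or [- u], it is any unit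
   vector orthogonal to [u]. *)
Lemma great_circle u v : (2 <= m)%N -> dot u u = 1 -> dot v v = 1 ->
  exists w, [/\ dot w w = 1, dot u w = 0 &
    v = cos (acos (dot u v)) *: u + sin (acos (dot u v)) *: w].
Proof.
move=> m2 u1 v1; have uv := dot_unit_bound u1 v1.
rewrite acosK ?in_itv// sin_acos//.
set x := dot u v in uv *; set y := v - x *: u.
have uy : dot u y = 0 by rewrite dotDr dotNr dotZr u1 mulr1 subrr.
have yy : dot y y = 1 - x ^+ 2.
  by rewrite /y !(dotDl, dotDr, dotNl, dotNr, dotZl, dotZr) (dotC v u) u1 v1 -/x; ring.
rewrite -yy -/(enorm y).
have [y0|y0] := eqVneq y 0.
  have [w w1 uw] := orthogonal_unit m2 u1; exists w; split => //.
  rewrite y0 enorm0 scale0r addr0.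
  by apply/eqP; rewrite -subr_eq0 -/y y0.
have l0 := enorm_gt0 y0.
exists ((enorm y)^-1 *: y); split.
- by rewrite dotZl dotZr -sqr_enorm; field; rewrite gt_eqF.
- by rewrite dotZr uy mulr0.
- by rewrite scalerA divff ?gt_eqF// scale1r addrC subrK.
Qed.

End GreatCircle.

(** * Smooth functions of one variable *)

Section Smooth.
Context {R : realType}.
Implicit Types f g : R -> R.

(** [m + 1] times differentiable everywhere. The recursion peels off the innermost
   derivative, so that closure properties follow by induction from the formulas
   for one derivative. *)
Fixpoint cdiff (m : nat) f : Prop :=
  (forall x, derivable f x 1) /\
  (if m is m'.+1 then cdiff m' (f^`())%classic else True).

Lemma smoothP f : smooth f <-> forall m, cdiff m f.
Proof.
split=> [fs m|h m].
  elim: m f fs => [|m IH] f fs /=; split=> //; [exact: (fs 0)|exact: (fs 0)|].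
  by apply: IH => j t; rewrite -derive1Sn; exact: fs.
elim: m f h => [|m IH] f h t; first by have [] := h 0%N.
by rewrite derive1Sn; apply: IH => j; have [] := h j.+1.
Qed.

Lemma cdiff_derivable m f (x : R) : cdiff m f -> derivable f x 1.
Proof. by case: m => [|m] []. Qed.

Lemma cdiffW m f : cdiff m.+1 f -> cdiff m f.
Proof.
elim: m f => [|m IH] f [fd f']; first by split.
by split=> //; exact: IH.
Qed.

Lemma cdiff_is_derive f g : (forall x : R, is_derive x 1 f (g x)) ->
  forall m, cdiff m g -> cdiff m.+1 f.
Proof.
move=> fg m gm; split; first by move=> x; exact: ex_derive.
rewrite (_ : (f^`())%classic = g)//; apply/funext => x.
by rewrite derive1E derive_val.
Qed.

Lemma cdiff_derive m f (x : R) : cdiff m f -> is_derive x 1 f ((f^`())%classic x).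
Proof.
move=> fm; rewrite derive1E; apply: derivableP; exact: cdiff_derivable fm.
Qed.

Lemma cdiff_cst m (a : R) : cdiff m (fun=> a).
Proof.
elim: m a => [|m IH] a; first by split=> // x; exact: derivable_cst.
by apply: (@cdiff_is_derive _ (fun=> 0)) => // x; exact: is_derive_cst.
Qed.

Lemma cdiff_id m : cdiff m (fun x : R => x).
Proof.
case: m => [|m]; first by split=> // x; exact: derivable_id.
apply: (@cdiff_is_derive _ (fun=> 1)) (cdiff_cst _ _).
Qed.

Lemma cdiffD m f g : cdiff m f -> cdiff m g -> cdiff m (fun x => f x + g x).
Proof.
elim: m f g => [|m IH] f g fm gm.
  by split=> // x; apply: derivableD; [exact: cdiff_derivable fm|exact: cdiff_derivable gm].
apply: (cdiff_is_derive _ (IH _ _ fm.2 gm.2)) => x.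
by apply: is_deriveD; [exact: cdiff_derive fm|exact: cdiff_derive gm].
Qed.

Lemma cdiffM m f g : cdiff m f -> cdiff m g -> cdiff m (fun x => f x * g x).
Proof.
elim: m f g => [|m IH] f g fm gm.
  by split=> // x; apply: derivableM; [exact: cdiff_derivable fm|exact: cdiff_derivable gm].
apply: (cdiff_is_derive _ (cdiffD (IH _ _ (cdiffW fm) gm.2) (IH _ _ (cdiffW gm) fm.2))) => x.
by apply: is_deriveM; [exact: cdiff_derive fm|exact: cdiff_derive gm].
Qed.

Lemma cdiff_comp m f g : cdiff m f -> cdiff m g -> cdiff m (fun x => f (g x)).
Proof.
elim: m f g => [|m IH] f g fm gm.
  split=> // x.
  have df := cdiff_derive (g x) fm; have dg := cdiff_derive x gm.
  by have := is_derive1_comp df dg => /@ex_derive.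
apply: (cdiff_is_derive _ (cdiffM (IH _ _ fm.2 (cdiffW gm)) gm.2)) => x.
exact: is_derive1_comp (cdiff_derive (g x) fm) (cdiff_derive x gm).
Qed.

Lemma cdiffV m f : (forall x, f x != 0) -> cdiff m f -> cdiff m (fun x => (f x)^-1).
Proof.
move=> f0; elim: m f f0 => [|m IH] f f0 fm.
  by split=> // x; apply: derivableV => //; exact: cdiff_derivable fm.
have h := IH _ f0 (cdiffW fm).
apply: (cdiff_is_derive _ (cdiffM (cdiff_cst m (-1)) (cdiffM (cdiffM h h) fm.2))) => x.
apply: is_derive_eq.
  by apply: is_deriveV => //; exact: cdiff_derive fm.
by rewrite /GRing.scale/= expr2 invfM mulN1r mulNr.
Qed.

Lemma cdiff_sqrt m f : (forall x, 0 < f x) -> cdiff m f -> cdiff m (fun x => Num.sqrt (f x)).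
Proof.
move=> f0; elim: m f f0 => [|m IH] f f0 fm.
  split=> // x.
  have df := cdiff_derive x fm.
  by have := is_derive1_comp (is_derive1_sqrt (f0 x)) df => /@ex_derive.
have h := IH _ f0 (cdiffW fm).
apply: (cdiff_is_derive _ (cdiffM (cdiffV _ (cdiffM (cdiff_cst m 2) h)) fm.2)) => x.
  exact: is_derive1_comp (is_derive1_sqrt (f0 x)) (cdiff_derive x fm).
by rewrite mulf_neq0// ?pnatr_eq0// sqrtr_eq0 -ltNge.
Qed.

(** Sine and cosine are each other's derivative, up to sign, so the induction
   proves both at once. *)
Lemma cdiff_sin_cos m : cdiff m (@sin R) /\ cdiff m (@cos R).
Proof.
elim: m => [|m [sm cm]]; first by split; split=> // x; exact: ex_derive.
split; first exact: (cdiff_is_derive _ cm).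
apply: (cdiff_is_derive _ (cdiffM (cdiff_cst m (-1)) sm)) => x.
by rewrite mulN1r; exact: is_derive_cos.
Qed.

Lemma cdiff_atan m : cdiff m (@atan R).
Proof.
case: m => [|m]; first by split=> // x; exact: ex_derive.
have datan (x : R) : is_derive x 1 (@atan R) (1 + x * x)^-1.
  by rewrite -expr2; exact: is_derive1_atan.
apply: (cdiff_is_derive datan).
apply: cdiffV; last exact: cdiffD (cdiff_cst _ _) (cdiffM (cdiff_id _) (cdiff_id _)).
by move=> x; rewrite gt_eqF// ltr_pwDl// -expr2 sqr_ge0.
Qed.

Lemma smooth_cst (a : R) : smooth (fun=> a).
Proof. by apply/smoothP => m; exact: cdiff_cst. Qed.

Lemma smooth_id : smooth (fun x : R => x).
Proof. by apply/smoothP => m; exact: cdiff_id. Qed.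

Lemma smooth_sin : smooth (@sin R).
Proof. by apply/smoothP => m; case: (cdiff_sin_cos m). Qed.

Lemma smooth_cos : smooth (@cos R).
Proof. by apply/smoothP => m; case: (cdiff_sin_cos m). Qed.

Lemma smooth_atan : smooth (@atan R).
Proof. by apply/smoothP => m; exact: cdiff_atan. Qed.

Lemma smoothD f g : smooth f -> smooth g -> smooth (fun x => f x + g x).
Proof. by move=> /smoothP fs /smoothP gs; apply/smoothP => m; exact: cdiffD. Qed.

Lemma smoothM f g : smooth f -> smooth g -> smooth (fun x => f x * g x).
Proof. by move=> /smoothP fs /smoothP gs; apply/smoothP => m; exact: cdiffM. Qed.

Lemma smooth_comp f g : smooth f -> smooth g -> smooth (fun x => f (g x)).
Proof. by move=> /smoothP fs /smoothP gs; apply/smoothP => m; exact: cdiff_comp. Qed.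

Lemma smooth_sqrt f : (forall x, 0 < f x) -> smooth f -> smooth (fun x => Num.sqrt (f x)).
Proof. by move=> f0 /smoothP fs; apply/smoothP => m; exact: cdiff_sqrt. Qed.

Lemma smooth_prod (J : finType) (F : J -> R -> R) :
  (forall j, smooth (F j)) -> smooth (fun x => \prod_j F j x).
Proof.
move=> Fs.
have -> : (fun x => \prod_j F j x) = \big[(fun f g x => f x * g x)/(fun=> 1)]_j F j.
  apply/funext => x.
  by elim/big_rec2 : _ => // j y1 y2 _ ->.
elim/big_ind : _ => //; first exact: smooth_cst.
exact: smoothM.
Qed.

Lemma smooth_derivable f (x : R) : smooth f -> derivable f x 1.
Proof. by move=> fs; exact: (fs 0%N). Qed.

Lemma smooth_derive f : smooth f -> smooth (f^`())%classic.
Proof. by move=> fs m t; rewrite -derive1Sn; exact: fs. Qed.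

Lemma smooth_continuous f : smooth f -> continuous f.
Proof.
move=> fs x; apply: differentiable_continuous.
exact/derivable1_diffP/smooth_derivable.
Qed.

End Smooth.

(** * Speed as a limit of chords *)

Section Chord.
Context {R : realType} {I : finType}.
Local Notation E := {ffun I -> R}.
Implicit Types (x y p v w : E) (c : R -> E) (alpha t h : R).

Lemma warped_metric_diag alpha p v : p != 0 ->
  warped_metric alpha p v v = dot p v ^+ 2 / dot p p
    + alpha ^+ 2 * (dot v v - dot p v ^+ 2 / dot p p).
Proof.
move=> p0; have l0 := enorm_gt0 p0.
have pp := sqr_enorm p.
rewrite /warped_metric /angular /radial /direction.
rewrite !(dotDl, dotDr, dotNl, dotNr, dotZl, dotZr) (dotC v p) -!pp.
by field; rewrite gt_eqF.
Qed.

(** A substitute for the squared distance of nearby points, rational in norms and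
   the cosine of their angle: the angle enters through [tan ^ 2], which bounds its
   square from above and is equivalent to it near [0]. *)
Definition sqr_chord alpha x y : R :=
  (enorm x - enorm y) ^+ 2
  + enorm x * enorm y * (alpha ^+ 2 * (dot x x * dot y y / dot x y ^+ 2 - 1)).

Definition speed alpha c t : R :=
  Num.sqrt (warped_metric alpha (c t) (velocity c t) (velocity c t)).

Lemma derivable_quotient (f : R -> R) t : derivable f t 1 ->
  (h^-1 * (f (h + t) - f t)) @[h --> 0^'] --> (f^`())%classic t.
Proof.
move=> /cvg_ex[l hl].
have e : (fun h : R => h^-1 *: ((f \o shift t) (h *: 1) - f t))
  = (fun h => h^-1 * (f (h + t) - f t)).
  by apply/funext => h /=; rewrite /GRing.scale/= mulr1.
rewrite derive1E /derive e.
by move: hl; rewrite e => hl; rewrite (cvg_lim _ hl).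
Qed.

Lemma cvg_dot (F : set_system R) {FF : Filter F} (f g : R -> E) x y :
  (forall i, f h i @[h --> F] --> x i) -> (forall i, g h i @[h --> F] --> y i) ->
  dot (f h) (g h) @[h --> F] --> dot x y.
Proof.
move=> fx gy; rewrite /dot.
have ac := @add_continuous R^o.
apply: (cvg_big ac (Ff := fun i h => f h i * g h i)) => i _.
exact: cvgM.
Qed.

Lemma cvg_target_eq (F : set_system R) (f : R -> R) (a b : R) :
  f h @[h --> F] --> a -> a = b -> f h @[h --> F] --> b.
Proof. by move=> fa <-. Qed.

Lemma cvg_shift (f : R -> R) t : {for t, continuous f} ->
  f (h + t) @[h --> 0^'] --> f t.
Proof.
move=> fc; apply: (cvg_comp (fun h => h + t) f _ fc).
have h0 : (fun h : R => h) h @[h --> (0 : R)^'] --> (0 : R) by apply: cvg_within.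
by apply: cvg_target_eq (cvgD h0 (cvg_cst t)) _; rewrite add0r.
Qed.

Lemma dot_shift x w h : dot (x + h *: w) (x + h *: w) =
  dot x x + h * (2 * dot x w + h * dot w w).
Proof. by rewrite !(dotDl, dotDr, dotZl, dotZr) (dotC w x); ring. Qed.

(** The square of the tangent of the angle of [x] and [y] is their Gram determinant
   divided by [<x, y> ^ 2]; for [y = x + h *: w] the Gram determinant is that of [x]
   and [h *: w]. *)
Lemma chord_quotient alpha x w h : h != 0 -> x != 0 -> dot x (x + h *: w) != 0 ->
  sqr_chord alpha x (x + h *: w) / h ^+ 2 =
  ((2 * dot x w + h * dot w w) / (enorm x + enorm (x + h *: w))) ^+ 2
  + enorm x * enorm (x + h *: w) * (alpha ^+ 2 *
    ((dot x x * dot w w - dot x w ^+ 2) / dot x (x + h *: w) ^+ 2)).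
Proof.
move=> h0 x0 xy0.
have l0 := enorm_gt0 x0.
set m := enorm (x + h *: w).
have m0 : 0 <= m by exact: enorm_ge0.
have lm : enorm x + m != 0 by rewrite gt_eqF// ltr_wpDr.
have e1 : (2 * dot x w + h * dot w w) / (enorm x + m) = h^-1 * (m - enorm x).
  apply: (mulIf lm); rewrite mulfVK//.
  apply: (mulfI h0).
  have -> : h * (h^-1 * (m - enorm x) * (enorm x + m)) = m ^+ 2 - enorm x ^+ 2 by field.
  by rewrite !sqr_enorm dot_shift; ring.
have e2 : h ^+ 2 * (dot x x * dot w w - dot x w ^+ 2) =
    dot x x * dot (x + h *: w) (x + h *: w) - dot x (x + h *: w) ^+ 2.
  by rewrite dot_shift dotDr dotZr; ring.
rewrite e1 /sqr_chord -/m.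
have -> : dot x x * dot (x + h *: w) (x + h *: w) / dot x (x + h *: w) ^+ 2 - 1
   = h ^+ 2 * (dot x x * dot w w - dot x w ^+ 2) / dot x (x + h *: w) ^+ 2.
  by rewrite e2 mulrBl divff// expf_neq0.
by field; rewrite xy0.
Qed.

(** By [chord_quotient] the ratio depends continuously on the difference quotient
   [w h], which converges to the velocity. *)
Lemma chord_speed alpha c t : (forall i, derivable (fun s => c s i) t 1) ->
  c t != 0 ->
  (sqr_chord alpha (c t) (c (h + t)) / h ^+ 2) @[h --> 0^'] -->
  warped_metric alpha (c t) (velocity c t) (velocity c t).
Proof.
move=> cd ct0; set v := velocity c t; set x := c t.
pose w h : E := [ffun i => h^-1 * (c (h + t) i - c t i)].
have wv i : w h i @[h --> 0^'] --> v i.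
  rewrite (_ : (fun h => w h i) = (fun h => h^-1 * (c (h + t) i - c t i))).
    by rewrite ffunE; exact: derivable_quotient.
  by apply/funext => h; rewrite ffunE.
have xE h : h != 0 -> c (h + t) = x + h *: w h.
  move=> h0; apply/ffunP => i; rewrite !ffunE /GRing.scale/= mulVKf//.
  by rewrite [RHS]addrC subrK.
have xw : dot x (w h) @[h --> 0^'] --> dot x v.
  by apply: cvg_dot => // i; exact: cvg_cst.
have ww : dot (w h) (w h) @[h --> 0^'] --> dot v v by apply: cvg_dot.
have h0 : (fun h : R => h) h @[h --> (0 : R)^'] --> (0 : R) by apply: cvg_within.
have xx : 0 < dot x x by rewrite -sqr_enorm exprn_gt0// enorm_gt0.
have xy : dot x (x + h *: w h) @[h --> 0^'] --> dot x x.
  under eq_fun do rewrite dotDr dotZr.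
  apply: cvg_target_eq (cvgD (cvg_cst (dot x x)) (cvgM h0 xw)) _.
  by rewrite mul0r addr0.
have a1 : (2 * dot x (w h) + h * dot (w h) (w h)) @[h --> 0^'] --> 2 * dot x v.
  apply: cvg_target_eq (cvgD (cvgM (cvg_cst (2 : R)) xw) (cvgM h0 ww)) _.
  by rewrite mul0r addr0.
have yy : dot (x + h *: w h) (x + h *: w h) @[h --> 0^'] --> dot x x.
  under eq_fun do rewrite dot_shift.
  apply: cvg_target_eq (cvgD (cvg_cst (dot x x)) (cvgM h0 a1)) _.
  by rewrite mul0r addr0.
have my : enorm (x + h *: w h) @[h --> 0^'] --> enorm x.
  exact: (cvg_comp _ _ yy (@sqrt_continuous R _)).
have l0 := enorm_gt0 ct0; rewrite -/x in l0.
have -> : warped_metric alpha x v v =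
  ((2 * dot x v) / (enorm x + enorm x)) ^+ 2
  + enorm x * enorm x * (alpha ^+ 2 *
    ((dot x x * dot v v - dot x v ^+ 2) / dot x x ^+ 2)).
  rewrite warped_metric_diag// -!sqr_enorm -/(enorm x); field.
  by rewrite gt_eqF// -mulr2n mulrn_eq0/= gt_eqF.
apply: (@cvg_trans _ ((((2 * dot x (w h) + h * dot (w h) (w h))
      / (enorm x + enorm (x + h *: w h))) ^+ 2
  + enorm x * enorm (x + h *: w h) * (alpha ^+ 2 *
    ((dot x x * dot (w h) (w h) - dot x (w h) ^+ 2)
      / dot x (x + h *: w h) ^+ 2))) @[h --> 0^'])).
  apply: near_eq_cvg; near=> h.
  have hn0 : h != 0 by near: h; exact: nbhs_dnbhs_neq.
  rewrite xE// chord_quotient//.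
  rewrite gt_eqF//; near: h.
  exact: (cvgr_gt (dot x x)).
apply: cvgD.
  rewrite expr2; under eq_fun do rewrite expr2.
  by apply: cvgM; apply: cvgM => //; apply: cvgV;
    rewrite ?gt_eqF ?addr_gt0//; apply: cvgD => //; exact: cvg_cst.
apply: cvgM; first by apply: cvgM => //; exact: cvg_cst.
apply: cvgM; first exact: cvg_cst.
apply: cvgM.
  apply: cvgB; first by apply: cvgM => //; exact: cvg_cst.
  by rewrite expr2; under eq_fun do rewrite expr2; exact: cvgM.
apply: cvgV; first by rewrite expf_neq0// gt_eqF.
by rewrite expr2; under eq_fun do rewrite expr2; exact: cvgM.
Unshelve. all: by end_near. Qed.

End Chord.

(** * Bounds for the length of a curve *)

Section Dini.
Context {R : realType}.
Implicit Types (F L : R -> R) (s t x y : R).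

(** Mean value inequality for one-sided difference quotients: the set of
   points up to which the estimate holds with slope error [e] is closed under
   suprema and open to the right. *)
Lemma right_quotient_le F L s t : s <= t ->
  {in `[s, t] &, {homo L : x y / x <= y}} ->
  (forall z e, s < z <= t -> 0 < e -> \forall x \near z^'-, F z <= F x + e) ->
  (forall x e, s <= x < t -> 0 < e ->
    \forall y \near x^'+, F y - F x <= L y - L x + e * (y - x)) ->
  F t - F s <= L t - L s.
Proof.
move=> st Lhomo Fl Fr.
apply/ler_addgt0Pr => e' e'0.
(* The added [1] makes the slope error meaningful when [s = t]. *)
pose e := e' / (t - s + 1).
have ts1 : 0 < t - s + 1 by rewrite ltr_wpDl// subr_ge0.
have e0 : 0 < e by rewrite divr_gt0.
pose S := [set x | s <= x <= t /\ F x - F s <= L x - L s + e * (x - s)].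
have Ss : S s by split; [rewrite lexx st|rewrite !subrr mulr0 addr0].
have Sub : ubound S t by move=> x [/andP[]].
have Ssup : has_sup S by split; [exists s|exists t].
pose z := sup S.
have sz : s <= z by exact: (ub_le_sup (ex_intro _ t Sub)).
have zt : z <= t by apply: ge_sup => //; exists s.
have Sz : S z.
  have [->//|zs] := eqVneq z s.
  have {zs} sz' : s < z by rewrite lt_def zs.
  split; first by rewrite sz.
  apply/ler_addgt0Pr => eta eta0.
  have [d /= d0 dP] := Fl z eta (introT andP (conj sz' zt)) eta0.
  have [x Sx zdx] := sup_adherent d0 Ssup.
  have xz : x <= z by exact: (ub_le_sup (ex_intro _ t Sub)).
  case: Sx => /andP[sx xt] xS.
  have Fzx : F z <= F x + eta.
    move: xz; rewrite le_eqVlt => /orP[/eqP->|xz]; first by rewrite lerDl ltW.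
    apply: (dP x) => //=; rewrite ger0_norm ?subr_ge0 ?ltW//.
    by rewrite ltrBlDr -ltrBlDl.
  have Lxz : L x <= L z by apply: Lhomo; rewrite ?in_itv/= ?sx ?sz.
  have : e * (x - s) <= e * (z - s) by rewrite ler_pM2l// lerD2r.
  lra.
have tz : z = t.
  apply/eqP; rewrite eq_le zt/= leNgt; apply/negP => zt'.
  have [d /= d0 dP] := Fr z e (introT andP (conj sz zt')) e0.
  pose y := Num.min (z + d / 2) t.
  have zy : z < y by rewrite lt_min zt' andbT ltrDl divr_gt0.
  have yt : y <= t by rewrite ge_min lexx orbT.
  have yd : y <= z + d / 2 by rewrite ge_min lexx.
  suff : S y by move=> /(ub_le_sup (ex_intro _ t Sub)); rewrite leNgt zy.
  split; first by rewrite yt (le_trans sz)// ltW.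
  have : F y - F z <= L y - L z + e * (y - z).
    apply: dP => //=; rewrite distrC ger0_norm ?subr_ge0 ?ltW//.
    lra.
  case: Sz => _; lra.
case: Sz => _; rewrite tz => /le_trans; apply; rewrite lerD2l.
rewrite /e mulrAC ler_pdivrMr// ler_pM2l//; lra.
Qed.

End Dini.

Section PiecewiseSmooth.
Context {R : realType} {I : finType}.
Local Notation E := {ffun I -> R}.
Implicit Types (c : R -> E) (a b x y t : R).

(** Induction on the pieces, the last one first. *)
Lemma piecewise_smooth_ind (P : R -> Prop) b c : P b ->
  (forall x y, x < y -> y <= b -> smooth_on x y c -> P y -> P x) ->
  forall a, piecewise_smooth a b c -> P a.
Proof.
move=> Pb PS a [ts]; elim: ts a => [|y ts IH] a [tsP cP].
  by rewrite (itv_partition_nil tsP).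
have tsP' := itv_partition_cons tsP.
apply: (PS a y).
- by case: tsP => /= /andP[].
- exact: itv_partition_le tsP'.
- exact: (cP 0%N).
- by apply: IH; split=> // j jts; exact: (cP j.+1).
Qed.

Lemma piecewise_smooth_right a b c x : piecewise_smooth a b c -> a <= x < b ->
  exists2 y, x < y & smooth_on x y c.
Proof.
move=> cP.
apply: (@piecewise_smooth_ind
  (fun a => a <= x < b -> exists2 y, x < y & smooth_on x y c) b c _ _ a cP).
  by move=> /andP[bx xb]; have := le_lt_trans bx xb; rewrite ltxx.
move=> u v uv vb [c' [c's cc']] IH /andP[ux xb].
have [xv|vx] := ltP x v; last by apply: IH; rewrite vx.
exists v => //; exists c'; split=> // r; rewrite in_itv/= => /andP[xr rv].
by apply: cc'; rewrite in_itv/= rv (le_trans ux).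
Qed.

Lemma piecewise_smooth_left a b c x : piecewise_smooth a b c -> a < x <= b ->
  exists2 y, y < x & smooth_on y x c.
Proof.
move=> cP.
apply: (@piecewise_smooth_ind
  (fun a => a < x <= b -> exists2 y, y < x & smooth_on y x c) b c _ _ a cP).
  by move=> /andP[bx xb]; have := lt_le_trans bx xb; rewrite ltxx.
move=> u v uv vb [c' [c's cc']] IH /andP[ux xb].
have [xv|vx] := leP x v; last by apply: IH; rewrite vx.
exists u => //; exists c'; split=> // r; rewrite in_itv/= => /andP[xr rv].
by apply: cc'; rewrite in_itv/= xr (le_trans rv).
Qed.

Lemma velocity_oo c c' x y : {in `[x, y], c =1 c'} ->
  {in `]x, y[, velocity c =1 velocity c'}.
Proof.
move=> cc' t txy; apply/ffunP => i; rewrite !ffunE !derive1E.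
apply: near_eq_derive.
near=> s; rewrite cc'//.
have : s \in `]x, y[ by near: s; exact: near_in_itvoo.
exact: subset_itv_oo_cc.
Unshelve. all: by end_near. Qed.

End PiecewiseSmooth.

Section LengthLowerBound.
Context {R : realType} {I : finType}.
Local Notation E := {ffun I -> R}.
Implicit Types (p q : E) (c : R -> E) (a b e s t x y : R).
Variable alpha : R.

Lemma speed_continuous c t : (forall i, smooth (fun s => c s i)) -> c t != 0 ->
  speed alpha c x @[x --> t] --> speed alpha c t.
Proof.
move=> cs ct0.
have cc i : c s i @[s --> t] --> c t i by exact: (smooth_continuous (cs i)).
have vc i : velocity c s i @[s --> t] --> velocity c t i.
  rewrite ffunE (_ : (fun s => velocity c s i) = ((fun s => c s i)^`())%classic).
    exact: (smooth_continuous (smooth_derive (cs i))).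
  by apply/funext => s; rewrite ffunE.
have pp : dot (c s) (c s) @[s --> t] --> dot (c t) (c t) by exact: cvg_dot.
have pv : dot (c s) (velocity c s) @[s --> t] --> dot (c t) (velocity c t).
  exact: cvg_dot.
have vv : dot (velocity c s) (velocity c s) @[s --> t] -->
    dot (velocity c t) (velocity c t) by exact: cvg_dot.
have pp0 : 0 < dot (c t) (c t) by rewrite -sqr_enorm exprn_gt0// enorm_gt0.
pose g (p v : E) := dot p v * dot p v / dot p p
  + alpha ^+ 2 * (dot v v - dot p v * dot p v / dot p p) : R.
have gE s : c s != 0 -> speed alpha c s = Num.sqrt (g (c s) (velocity c s)).
  by move=> cs0; rewrite /speed warped_metric_diag// !expr2.
rewrite gE//.
apply: (@cvg_trans _ (Num.sqrt (g (c s) (velocity c s)) @[s --> t])).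
  apply: near_eq_cvg; near=> s; rewrite gE//.
  apply/eqP => cs0; have : 0 < dot (c s) (c s) by near: s; exact: (cvgr_gt _ pp).
  by rewrite cs0 dot0l ltxx.
apply: (cvg_comp _ Num.sqrt _ (@sqrt_continuous R _)).
have q : dot (c s) (velocity c s) * dot (c s) (velocity c s) / dot (c s) (c s) @[s --> t]
    --> dot (c t) (velocity c t) * dot (c t) (velocity c t) / dot (c t) (c t).
  by apply: cvgM; [exact: cvgM|apply: cvgV => //; rewrite gt_eqF].
by apply: cvgD => //; apply: cvgM; [exact: cvg_cst|exact: cvgB].
Unshelve. all: by end_near. Qed.

Lemma speed_oo c c' x y : {in `[x, y], c =1 c'} ->
  {in `]x, y[, speed alpha c =1 speed alpha c'}.
Proof.
move=> cc' t txy; rewrite /speed (velocity_oo cc' txy) cc'//.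
exact: subset_itv_oo_cc.
Qed.

(** The speed is continuous inside each piece; the breakpoints do not matter for
   measurability. *)
Lemma speed_measurable a b c : piecewise_smooth a b c ->
  {in `[a, b], forall t, c t != 0} -> measurable_fun `[a, b] (speed alpha c).
Proof.
move=> cP.
apply: (@piecewise_smooth_ind _ _ (fun a => {in `[a, b], forall t, c t != 0} ->
  measurable_fun `[a, b] (speed alpha c)) b c _ _ a cP).
  by move=> _; rewrite set_itv1; exact: measurable_fun_set1.
move=> x y xy yb [c' [c's cc']] IH c0.
rewrite (@itv_bndbnd_setU _ _ _ (BRight y)) ?bnd_simp ?(ltW xy)//.
apply/measurable_funU => //; split; last first.
  apply: (@measurable_funS _ _ _ _ `[y, b]) => //.
    by apply: subset_itvr; rewrite bnd_simp.
  apply: IH => t; rewrite in_itv/= => /andP[yt tb].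
  by apply: c0; rewrite in_itv/= tb (le_trans _ yt)// ltW.
apply: (@measurable_fun_itv_cc _ x y false true).
apply: (@eq_measurable_fun _ _ _ _ _ (speed alpha c')).
  by move=> t; rewrite inE/= => txy; rewrite (speed_oo cc').
apply: open_continuous_measurable_fun; first exact: interval_open.
move=> t; rewrite inE/= => txy; apply: speed_continuous => //.
have txy' := subset_itv_oo_cc txy.
rewrite -cc'//; apply: c0; move: txy'; rewrite !in_itv/= => /andP[-> ty].
exact: le_trans ty yb.
Qed.

Variables (M : set E) (F : E -> R) (a b : R) (c : R -> E).
Hypothesis M0 : forall p, M p -> p != 0.
Hypothesis Fchord : forall p q, M p -> M q -> 0 < dot p q ->
  (F p - F q) ^+ 2 <= sqr_chord alpha p q.
Hypothesis cP : piecewise_smooth a b c.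
Hypothesis cM : {in `[a, b], forall t, M (c t)}.

Local Notation len s t := (curve_length (warped_metric alpha) s t c).

Lemma curve_neq0 : {in `[a, b], forall t, c t != 0}.
Proof. by move=> t tab; apply: M0; exact: cM. Qed.

Lemma speed_measurable_sub (i : interval R) : [set` i] `<=` `[a, b] ->
  measurable_fun [set` i] (EFin \o speed alpha c).
Proof.
move=> iab; apply/measurable_EFinP.
apply: (@measurable_funS _ _ _ _ `[a, b]) => //.
exact: speed_measurable curve_neq0.
Qed.

Lemma length_split s x t : a <= s -> s <= x <= t -> t <= b ->
  (len s t = len s x + len x t)%E.
Proof.
move=> as_ /andP[sx xt] tb.
have sub u v : s <= u -> v <= t -> `[u, v] `<=` `[a, b].
  move=> su vt r; rewrite /= !in_itv/= => /andP[ur rv].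
  by rewrite (le_trans as_)// ?(le_trans su)// (le_trans rv)// (le_trans vt).
rewrite /curve_length (@itv_bndbnd_setU _ _ _ (BRight x)) ?bnd_simp//.
rewrite ge0_integral_setU//.
- congr (_ + _)%E; rewrite integral_itv_obnd_cbnd//.
  apply: speed_measurable_sub; apply: subset_trans (sub x t sx (lexx t)).
  by apply: subset_itvr; rewrite bnd_simp.
- rewrite -(@itv_bndbnd_setU _ _ _ (BRight x)) ?bnd_simp//.
  by apply: speed_measurable_sub; exact: sub.
- apply/disj_setPS => r [] /=; rewrite !in_itv/= => /andP[_ rx] /andP[xr _].
  by have := lt_le_trans xr rx; rewrite ltxx.
Qed.

Lemma len_ge0 s t : (0 <= len s t)%E.
Proof. by apply: integral_ge0 => r _; rewrite lee_fin sqrtr_ge0. Qed.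

(** By [chord_speed], the square root of [sqr_chord] between nearby points of a
   smooth curve is to first order the speed times the change of the parameter. *)
Lemma F_growth c' x e : (forall i, smooth (fun s => c' s i)) -> M (c' x) -> 0 < e ->
  exists2 d, 0 < d & forall y, `|y - x| < d -> M (c' y) ->
    `|F (c' y) - F (c' x)| <= (speed alpha c' x + e) * `|y - x|.
Proof.
move=> c's Mx e0; have x0 := M0 Mx.
have dc i : derivable (fun s => c' s i) x 1 by exact: smooth_derivable.
have chord_lt : \forall h \near 0^', Num.sqrt (sqr_chord alpha (c' x) (c' (h + x)) / h ^+ 2)
    < speed alpha c' x + e.
  have := cvg_comp _ Num.sqrt (@chord_speed _ _ alpha _ _ dc x0) (@sqrt_continuous R _).
  by move=> /cvgr_lt; apply; rewrite ltrDl.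
have dotx : \forall h \near 0^', 0 < dot (c' x) (c' (h + x)).
  have : dot (c' x) (c' y) @[y --> x] --> dot (c' x) (c' x).
    by apply: cvg_dot => i; [exact: cvg_cst|exact: (smooth_continuous (c's i))].
  move=> /cvgr_gt/(_ _ (dot_gt0 x0)) [d /= d0 dP].
  exists d => //= h /=; rewrite sub0r normrN => hd _; apply: dP => /=.
  by rewrite opprD addrCA subrr addr0 normrN.
have [d /= d0 dP] : \forall h \near 0^',
    Num.sqrt (sqr_chord alpha (c' x) (c' (h + x)) / h ^+ 2)
    < speed alpha c' x + e /\ 0 < dot (c' x) (c' (h + x)) by near=> h; split; near: h.
exists d => // y yd My.
have [->|yx] := eqVneq y x; first by rewrite !subrr normr0 mulr0.
have [] := dP (y - x); rewrite /= ?sub0r ?normrN ?subr_eq0// subrK => h1 h2.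
have yx0 : 0 < `|y - x| by rewrite normr_gt0 subr_eq0.
rewrite -ler_pdivrMr//; apply: le_trans (ltW h1).
apply: ler_sqrt_of_sqr.
rewrite expr_div_n -!normrX ger0_norm ?sqr_ge0// [X in _ / X]ger0_norm ?sqr_ge0//.
rewrite ler_pM2r; last by rewrite invr_gt0 exprn_even_gt0//= subr_eq0.
by rewrite -sqrrN opprB; exact: Fchord.
Unshelve. all: by end_near. Qed.

(** To the right of [x] the curve agrees with a smooth one, whose speed is
   continuous: [V] is the right-hand limit of the speed at [x]. *)
Lemma right_step x e : a <= x < b -> 0 < e -> exists d V : R, 0 < d /\
  forall y, x < y < x + d -> [/\ y <= b,
    `|F (c y) - F (c x)| <= (V + e) * (y - x) &
    (((V - e) * (y - x))%:E <= len x y)%E].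
Proof.
move=> axb e0; have [x' xx' [c' [c's cc']]] := piecewise_smooth_right cP axb.
have /andP[ax xb] := axb.
have xab : x \in `[a, b] by rewrite in_itv/= ax ltW.
have cx : c x = c' x by apply: cc'; rewrite in_itv/= lexx ltW.
have Mx : M (c' x) by rewrite -cx; exact: cM.
have [d1 d10 H1] := F_growth c's Mx e0.
have : \forall y \near x, speed alpha c' x - e < speed alpha c' y.
  have /cvgr_gt := speed_continuous c's (M0 Mx).
  by apply; rewrite ltrBlDr ltrDl.
move=> [d2 /= d20 H2].
exists (Num.min (Num.min d1 d2) (Num.min (x' - x) (b - x))), (speed alpha c' x).
split; first by rewrite !lt_min d10 d20 !subr_gt0 xx' xb.
move=> y /andP[xy]; rewrite -ltrBlDl !lt_min !ltrD2r => /andP[/andP[yd1 yd2] /andP[yx' yb]].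
have cy : c y = c' y by apply: cc'; rewrite in_itv/= !ltW.
have My : M (c' y) by rewrite -cy; apply: cM; rewrite in_itv/= (le_trans ax) ?ltW.
have yx0 : 0 < y - x by rewrite subr_gt0.
split; first exact: ltW.
  rewrite cy cx -[X in _ <= _ * X](ger0_norm (ltW yx0)); apply: H1 => //.
  by rewrite ger0_norm// ltW.
(* A negative lower bound for the speed says nothing about its integral. *)
have [Ve|Ve] := leP (speed alpha c' x - e) 0.
  apply: le_trans (len_ge0 _ _); rewrite lee_fin.
  by rewrite mulr_le0_ge0// ltW.
have mxy : measurable_fun `]x, y[ (EFin \o speed alpha c).
  apply: speed_measurable_sub => r; rewrite /= !in_itv/= => /andP[xr ry].
  by rewrite (le_trans ax) ?(ltW xr)//= (le_trans (ltW ry))// ltW.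
rewrite /curve_length (integral_itv_bndoo true false mxy).
have := @ge0_le_integral _ _ R lebesgue_measure `]x, y[ (measurable_itv _)
  (fun=> (speed alpha c' x - e)%:E) (EFin \o speed alpha c).
rewrite integral_cst//= lebesgue_measure_itv/= lte_fin xy -EFinB -EFinM; apply => //.
- by move=> r _; rewrite lee_fin ltW.
- move=> r xry; rewrite lee_fin (@speed_oo c c' x x')//.
    apply/ltW/H2 => /=; move: xry; rewrite in_itv/= => /andP[xr ry].
    rewrite distrC ger0_norm ?subr_ge0 ?(ltW xr)//.
    by apply: lt_trans yd2; rewrite ltrD2r.
  move: xry; rewrite !in_itv/= => /andP[-> /lt_trans]; exact.
Qed.

Lemma left_step x e : a < x <= b -> 0 < e -> exists d V : R, 0 < d /\
  forall y, x - d < y < x -> a <= y /\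
    `|F (c y) - F (c x)| <= (V + e) * (x - y).
Proof.
move=> axb e0; have [x' xx' [c' [c's cc']]] := piecewise_smooth_left cP axb.
have /andP[ax xb] := axb.
have xab : x \in `[a, b] by rewrite in_itv/= xb ltW.
have cx : c x = c' x by apply: cc'; rewrite in_itv/= lexx ltW.
have Mx : M (c' x) by rewrite -cx; exact: cM.
have [d1 d10 H1] := F_growth c's Mx e0.
exists (Num.min d1 (Num.min (x - x') (x - a))), (speed alpha c' x).
split; first by rewrite !lt_min d10 !subr_gt0 xx' ax.
move=> y /andP[yd yx].
have : x - y < Num.min d1 (Num.min (x - x') (x - a)) by move: yd; lra.
rewrite !lt_min !ltrD2l !ltrN2 => /andP[yd1 /andP[yx' ya]].
have cy : c y = c' y by apply: cc'; rewrite in_itv/= !ltW.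
have My : M (c' y) by rewrite -cy; apply: cM; rewrite in_itv/= !ltW// (lt_le_trans yx).
have yx0 : 0 < x - y by rewrite subr_gt0.
split; first exact: ltW.
rewrite cy cx -[X in _ <= _ * X](ger0_norm (ltW yx0)) [X in _ <= _ * X]distrC; apply: H1 => //.
by rewrite distrC ger0_norm// ltW.
Qed.

Lemma F_cvg_right x : a <= x < b -> F (c y) @[y --> x^'+] --> F (c x).
Proof.
move=> axb; have [d [V [d0 H]]] := right_step axb ltr01.
apply/cvgrPdist_le => e e0.
have V1 : 0 < `|V + 1| + 1 by rewrite ltr_wpDl.
near=> y.
have xy : x < y by [].
have yx0 : 0 < y - x by rewrite subr_gt0.
have [|_ h _] := H y; first by rewrite xy/=; near: y; apply: nbhs_right_lt; rewrite ltrDl.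
rewrite distrC; apply: (le_trans h).
apply: (@le_trans _ _ ((`|V + 1| + 1) * (y - x))).
  by rewrite ler_pM2r//; have := ler_norm (V + 1); lra.
rewrite -ler_pdivlMl// mulrC lerBlDl.
by near: y; apply: nbhs_right_le; rewrite ltrDl divr_gt0.
Unshelve. all: by end_near. Qed.

Lemma F_cvg_left x : a < x <= b -> F (c y) @[y --> x^'-] --> F (c x).
Proof.
move=> axb; have [d [V [d0 H]]] := left_step axb ltr01.
apply/cvgrPdist_le => e e0.
have V1 : 0 < `|V + 1| + 1 by rewrite ltr_wpDl.
near=> y.
have xy : y < x by [].
have yx0 : 0 < x - y by rewrite subr_gt0.
have [|_ h] := H y; first by rewrite xy andbT; near: y; apply: nbhs_left_gt; rewrite gtrBl.
rewrite distrC; apply: (le_trans h).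
apply: (@le_trans _ _ ((`|V + 1| + 1) * (x - y))).
  by rewrite ler_pM2r//; have := ler_norm (V + 1); lra.
rewrite -ler_pdivlMl// mulrC lerBlDr -lerBlDl.
by near: y; apply: nbhs_left_ge; rewrite gtrBl divr_gt0.
Unshelve. all: by end_near. Qed.

Lemma F_continuous : a < b -> {within `[a, b], continuous (F \o c)}.
Proof.
move=> ab; apply/continuous_within_itvP => //; split.
- move=> x; rewrite in_itv/= => /andP[ax xb].
  apply/left_right_continuousP; split.
    by apply: F_cvg_left; rewrite ax ltW.
  by apply: F_cvg_right; rewrite xb ltW.
- by apply: F_cvg_right; rewrite lexx.
- by apply: F_cvg_left; rewrite lexx ab.
Qed.

(** The length is additive and, by [right_step], grows to the right of each point
   at least as fast as [F] along the curve. *)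
Lemma length_lower_bound s t : a <= s -> s <= t -> t <= b ->
  ((F (c t) - F (c s))%:E <= len s t)%E.
Proof.
move=> as_ st tb.
have [->|lfin] := eqVneq (len s t) +oo%E; first by rewrite leey.
have lenfin z : s <= z <= t -> len s z \is a fin_num.
  move=> szt; rewrite ge0_fin_numE ?len_ge0//.
  apply: (@le_lt_trans _ _ (len s t)).
    by rewrite (@length_split s z t)// leeDl// len_ge0.
  by rewrite ltey.
pose L z := fine (len s z).
have LE z : s <= z <= t -> (L z)%:E = len s z by move=> zt; rewrite fineK// lenfin.
have Lsplit x y : s <= x -> x <= y -> y <= t -> ((L y)%:E = (L x)%:E + len x y)%E.
  move=> sx xy yt.
  rewrite !LE ?sx ?(le_trans sx)//= ?(le_trans xy)//.
  by apply: length_split; rewrite ?sx// (le_trans yt).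
have Ls : L s = 0.
  by rewrite /L /curve_length set_itv1 integral_set1.
rewrite -(LE t) ?st ?lexx// lee_fin -[leRHS]subr0 -Ls.
apply: (@right_quotient_le R (F \o c) L) => //.
- move=> x y; rewrite !in_itv/= => /andP[sx xt] /andP[sy yt] xy.
  by rewrite -lee_fin (Lsplit x y)// leeDl// len_ge0.
- move=> z e /andP[sz zt] e0.
  have zab : a < z <= b by rewrite (le_lt_trans as_) ?(le_trans zt).
  near=> x; rewrite -lerBlDl; apply: le_trans (ler_norm _) _.
  by near: x; move/cvgrPdist_le : (F_cvg_left zab); exact.
move=> x e /andP[sx xt] e0.
have xab : a <= x < b by rewrite (le_trans as_)//= (lt_le_trans xt).
have e20 : 0 < e / 2 by rewrite divr_gt0.
have [d [V [d0 H]]] := right_step xab e20.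
near=> y.
have xy : x < y by [].
have [|_ h1 h2] := H y; first by rewrite xy/=; near: y; apply: nbhs_right_lt; rewrite ltrDl.
have yt : y <= t by near: y; exact: nbhs_right_le.
have {}h2 : (V - e / 2) * (y - x) <= L y - L x.
  rewrite -lee_fin EFinB (Lsplit x y)// ?(ltW xy)// addeAC subee ?add0e//.
have {h1} : F (c y) - F (c x) <= (V + e / 2) * (y - x) by apply: le_trans (ler_norm _) h1.
rewrite /=; lra.
Unshelve. all: by end_near. Qed.

End LengthLowerBound.

Section LengthUpperBound.
Context {R : realType} {I : finType}.
Local Notation E := {ffun I -> R}.

Lemma smooth_piecewise (s t : R) (c : R -> E) : s < t ->
  (forall i, smooth (fun x => c x i)) -> piecewise_smooth s t c.
Proof.
move=> st cs; exists [:: t]; split; first exact: itv_partition1.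
by case=> // _; exists c; split.
Qed.

Lemma length_upper_bound (alpha s t : R) (c : R -> E) (f F : R -> R) : s < t ->
  (forall i, smooth (fun x => c x i)) -> {in `[s, t], forall x, c x != 0} ->
  (forall x : R, is_derive x 1 F (f x)) -> continuous f ->
  {in `[s, t], forall x, speed alpha c x <= f x} ->
  (curve_length (warped_metric alpha) s t c <= (F t - F s)%:E)%E.
Proof.
move=> st cs c0 dF fc sf.
have Fc : continuous F.
  by move=> x; apply/differentiable_continuous/derivable1_diffP; exact: ex_derive.
rewrite EFinB -(@continuous_FTC2 _ f F s t st).
- have ms : measurable_fun `[s, t] (EFin \o speed alpha c).
    by apply/measurable_EFinP; apply: (speed_measurable _ (smooth_piecewise st cs)) => //.
  have mf : measurable_fun `[s, t] (EFin \o f).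
    apply/measurable_EFinP; apply: measurable_funTS.
    exact: continuous_measurable_fun.
  apply: (@ge0_le_integral _ _ R lebesgue_measure `[s, t] (measurable_itv _)
    (EFin \o speed alpha c) (EFin \o f) _ ms mf) => x xst.
    by rewrite lee_fin sqrtr_ge0.
  by rewrite lee_fin; exact: sf.
- exact: continuous_subspaceT.
- split=> [x _||]; first exact: ex_derive.
    by apply: cvg_at_right_filter; exact: Fc.
  by apply: cvg_at_left_filter; exact: Fc.
- by move=> x _; rewrite derive1E derive_val.
Qed.

End LengthUpperBound.

(** * Angles between tensors of rank one *)

(** Distributivity for index types that depend on the factor, transported from the
   version for [fprod]. *)
Lemma prod_sum_dffun (R : comRingType) (I : finType) (T : I -> finType)
    (P : forall i, T i -> R) :
  \prod_i \sum_(x : T i) P i x =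
  \sum_(f : {dffun forall i, T i}) \prod_i P i (f i).
Proof.
rewrite (reindex (@dffun_of_fprod _ T)); last exact/onW_bij/dffun_of_fprod_bij.
transitivity (\sum_(t : fprod T) \prod_(i in I) [ffun x => P i x] (t i)).
  rewrite (@big_fprod R 0 1 *%R +%R I T (fun i => [ffun x => P i x])).
  pose F (i : I) (j : {i : I & T i}) : R := untag 0 [ffun x => P i x] j.
  rewrite -[RHS](bigA_distr_big_dep (fun i => tagged_with T i) F).
  apply: eq_bigr => i _; rewrite (big_tag (fun i x => P i x)).
  apply: eq_bigr => -[j x] /= /eqP ji; rewrite /F /untag/=.
  by case: eqP => // e; rewrite ffunE.
by apply: eq_bigr => t _; apply: eq_bigr => i _; rewrite !ffunE.
Qed.

Section Angle.
Context {R : realType} {d : nat} {n : 'I_d -> nat}.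
Variable k : 'I_d -> nat.
Hypothesis hk : forall i, (1 <= k i)%N.

Local Notation factors := (forall i : 'I_d, {ffun 'I_(n i) -> R}).
Implicit Types u v w : factors.

Definition unit_factors u : Prop := forall i, dot (u i) (u i) = 1.

(** The entries of both tensors are products over the factors, and so is the sum over
   all multi-indices of their products. *)
Lemma dot_rank_one u v :
  dot (rank_one k u) (rank_one k v) = \prod_i dot (u i) (v i) ^+ k i.
Proof.
rewrite /dot /rank_one.
transitivity (\prod_i \sum_(f : {ffun 'I_(k i) -> 'I_(n i)})
    \prod_(l < k i) (u i (f l) * v i (f l))).
  rewrite prod_sum_dffun; apply: eq_bigr => J _.
  rewrite !ffunE -big_split; apply: eq_bigr => i _.
  by rewrite -big_split.
apply: eq_bigr => i _.
rewrite -(bigA_distr_bigA (fun (l : 'I_(k i)) (j : 'I_(n i)) => u i j * v i j)).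
by rewrite prodr_const card_ord.
Qed.

Lemma enorm_rank_one u : unit_factors u -> enorm (rank_one k u) = 1.
Proof.
move=> u1; rewrite /enorm dot_rank_one big1 ?sqrtr1// => i _.
by rewrite u1 expr1n.
Qed.

(** The norm of this vector is the distance in the product of the spheres of radii
   [sqrt (k i)]. *)
Definition angles u v : {ffun 'I_d -> R} :=
  [ffun i => Num.sqrt (k i)%:R * acos (dot (u i) (v i))].

Definition prod_angle u v : R := enorm (angles u v).

Lemma sqr_prod_angle u v :
  prod_angle u v ^+ 2 = \sum_i (k i)%:R * acos (dot (u i) (v i)) ^+ 2.
Proof.
rewrite sqr_enorm; apply: eq_bigr => i _.
by rewrite ffunE -expr2 exprMn sqr_sqrtr.
Qed.

Lemma prod_angle_triangle u v w :
  unit_factors u -> unit_factors v -> unit_factors w ->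
  prod_angle u w <= prod_angle u v + prod_angle v w.
Proof.
move=> u1 v1 w1; apply: le_trans (enorm_triangle _ _).
apply: enorm_le => i; rewrite !ffunE -mulrDr.
rewrite mulr_ge0 ?sqrtr_ge0 ?acos_ge0 ?dot_unit_bound//=.
by rewrite ler_wpM2l ?sqrtr_ge0// acos_dot_triangle.
Qed.

Lemma prod_angle_refl u : unit_factors u -> prod_angle u u = 0.
Proof.
move=> u1; apply/eqP; rewrite -[_ == 0](@expf_eq0 R _ 2) sqr_prod_angle big1// => i _.
by rewrite u1 acos1 expr0n mulr0.
Qed.

(** The inequality [1 + t ^ 2 <= 1 / cos t ^ 2] for the angle [t] of each factor,
   multiplied over the factors. *)
Lemma sqr_prod_angle_le u v : unit_factors u -> unit_factors v ->
  (forall i, 0 < dot (u i) (v i)) ->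
  prod_angle u v ^+ 2 <= (dot (rank_one k u) (rank_one k v)) ^- 2 - 1.
Proof.
move=> u1 v1 uv0; rewrite lerBrDl sqr_prod_angle.
apply: le_trans (bernoulli_prod _ (fun i => sqr_ge0 _)) _.
rewrite dot_rank_one -prodrXl -prodfV; apply: ler_prod => i _.
rewrite exprn_ge0 ?addr_ge0 ?sqr_ge0//= exprAC -exprVn.
rewrite lerXn2r ?nnegrE ?addr_ge0 ?sqr_ge0 ?invr_ge0 ?sqr_ge0//.
apply: sqr_acos_le; rewrite uv0/=.
by have /andP[] := dot_unit_bound (u1 i) (v1 i).
Qed.

Definition flip (s : {ffun 'I_d -> bool}) u : factors := fun i => (-1) ^+ s i *: u i.

(** The tensor is multiplied by this sign, see [rank_one_flip]. *)
Definition flip_sign (s : {ffun 'I_d -> bool}) : R :=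
  \prod_i ((-1) ^+ s i) ^+ k i.

Lemma dot_rank_one_flip s u v :
  dot (rank_one k v) (rank_one k (flip s u)) =
  flip_sign s * dot (rank_one k v) (rank_one k u).
Proof.
rewrite !dot_rank_one /flip_sign -big_split; apply: eq_bigr => i _.
by rewrite dotZr exprMn.
Qed.

Lemma rank_one_flip s u : rank_one k (flip s u) = flip_sign s *: rank_one k u.
Proof.
apply/ffunP => J; rewrite !ffunE /GRing.scale/= /flip_sign -big_split.
apply: eq_bigr => i _.
under eq_bigr do rewrite ffunE.
by rewrite big_split prodr_const card_ord.
Qed.

Lemma unit_flip s u : unit_factors u -> unit_factors (flip s u).
Proof.
move=> u1 i; rewrite dotZl dotZr u1 mulr1.
by rewrite -expr2 sqrr_sign.
Qed.

Lemma flip_sign0 : flip_sign [ffun=> false] = 1.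
Proof. by apply: big1 => i _; rewrite ffunE expr0 expr1n. Qed.

Definition best_flip u v : {ffun 'I_d -> bool} :=
  [arg min_(s < [ffun=> false] | flip_sign s == 1) prod_angle u (flip s v)]%O.

(** The distance of the images of [u] and [v] in the quotient of the product of
   spheres by the changes of signs that do not change the tensor. *)
Definition angle u v : R := prod_angle u (flip (best_flip u v) v).

Lemma best_flipP u v : flip_sign (best_flip u v) = 1 /\
  forall s, flip_sign s = 1 -> angle u v <= prod_angle u (flip s v).
Proof.
rewrite /angle /best_flip; case: arg_minP; first by rewrite flip_sign0.
by move=> s /eqP s1 sP; split=> // r r1; apply: sP; rewrite r1.
Qed.

Lemma angle_ge0 u v : 0 <= angle u v. Proof. exact: enorm_ge0. Qed.

Lemma angle_refl u : unit_factors u -> angle u u = 0.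
Proof.
move=> u1; apply/eqP; rewrite eq_le angle_ge0 andbT -(prod_angle_refl u1).
have [_ /(_ _ flip_sign0)] := best_flipP u u.
rewrite (_ : flip _ u = u)//.
by apply: functional_extensionality_dep => i; rewrite /flip ffunE scale1r.
Qed.

(** Change the signs of the factors of [w] so that they make acute angles with those
   of the lift of [v] closest to [u]. As the two tensors have a positive inner
   product, this does not change the tensor, and the triangle inequality through
   the lift of [v] applies. *)
Lemma angle_lipschitz u v w :
  unit_factors u -> unit_factors v -> unit_factors w ->
  0 < dot (rank_one k v) (rank_one k w) ->
  angle u w <= angle u v + Num.sqrt ((dot (rank_one k v) (rank_one k w)) ^- 2 - 1).
Proof.
move=> u1 v1 w1.
have [s1 _] := best_flipP u v; rewrite /(angle u v).
set v' := flip (best_flip u v) v.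
have <- : rank_one k v' = rank_one k v by rewrite rank_one_flip s1 scale1r.
have v'1 : unit_factors v' by exact: unit_flip.
move=> vw0.
pose r : {ffun 'I_d -> bool} := [ffun i => dot (v' i) (w i) < 0].
have w'1 := unit_flip r w1.
have pos i : 0 < dot (v' i) (flip r w i).
  rewrite /flip dotZr ffunE.
  have : dot (v' i) (w i) != 0.
    apply: contraTneq vw0 => e; rewrite dot_rank_one (bigD1 i)//= e.
    by rewrite expr0n eqn0Ngt hk mul0r ltxx.
  case: (ltgtP (dot (v' i) (w i)) 0) => // h _.
    by rewrite expr1 mulN1r oppr_gt0.
  by rewrite expr0 mul1r.
have e := dot_rank_one_flip r w v'.
have r1 : flip_sign r = 1.
  have : 0 < flip_sign r.
    by rewrite -(pmulr_lgt0 _ vw0) -e dot_rank_one prodr_gt0// => i _; rewrite exprn_gt0.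
  have : flip_sign r ^+ 2 == 1.
    rewrite /flip_sign -prodrXl big1// => i _.
    by rewrite (exprAC _ (k i) 2) sqrr_sign expr1n.
  by rewrite sqrf_eq1 => /orP[/eqP//|/eqP->]; rewrite ltr0N1.
have [_ /(_ _ r1) h] := best_flipP u w.
apply: (le_trans h).
apply: le_trans (prod_angle_triangle u1 v'1 w'1) _; rewrite lerD2l.
apply: ler_sqrt_of_sqr.
have := sqr_prod_angle_le v'1 w'1 pos.
by rewrite e r1 mul1r.
Qed.

End Angle.

(** * Development of the cone in the plane *)

Section Development.
Context {R : realType} {d : nat} {n : 'I_d -> nat}.
Variable k : 'I_d -> nat.
Hypothesis hk : forall i, (1 <= k i)%N.
Local Notation factors := (forall i : 'I_d, {ffun 'I_(n i) -> R}).
Local Notation E := {ffun multi_index n k -> R}.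
Local Notation M := (@segre_veronese R d n k).
Implicit Types (u v : factors) (p q : E).
Variable alpha : R.
Hypothesis alpha0 : 0 < alpha.

Lemma unit_factorsP u : (forall i, enorm (u i) = 1) <-> unit_factors u.
Proof.
split=> h i; first by rewrite -sqr_enorm h expr1n.
by rewrite /enorm h sqrtr1.
Qed.

Definition is_lift (p : E) u := unit_factors u /\ p = enorm p *: rank_one k u.

Lemma segre_veronese_lift p : M p -> p != 0 /\ exists u, is_lift p u.
Proof.
move=> [l [u [l0 /unit_factorsP u1 ->]]].
have e : enorm (l *: rank_one k u) = l.
  rewrite /enorm dotZl dotZr -sqr_enorm enorm_rank_one// expr1n mulr1.
  by rewrite -expr2 sqrtr_sqr gtr0_norm.
split; last by exists u; split=> //; rewrite e.
apply: contraTneq l0 => lu; rewrite -e lu enorm0.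
by rewrite ltxx.
Qed.

Lemma segre_veronese_rank_one (l : R) u : 0 < l -> unit_factors u -> M (l *: rank_one k u).
Proof. by move=> l0 u1; exists l, u; split=> //; exact/unit_factorsP. Qed.

Section Lift.
Variable lift : E -> factors.
Hypothesis liftP : forall p, M p -> is_lift p (lift p).
Variable u : factors.
Hypothesis u1 : unit_factors u.

(** Truncated at [pi], beyond which the shortest planar path goes through the
   origin. *)
Definition dev_angle p : R := Num.min pi (alpha * angle k u (lift p)).

(** The point [p] is represented by the point of the plane with polar coordinates
   [enorm p] and [dev_angle p]; this is the coordinate of the latter along the unit
   vector at the angle [pi / 2 - b]. *)
Definition dev_coord b p : R := enorm p * sin (dev_angle p + b).

Lemma dev_angle_ge0 p : 0 <= dev_angle p.
Proof. by rewrite le_min pi_ge0 mulr_ge0 ?angle_ge0 ?ltW. Qed.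

Lemma dev_angle_lepi p : dev_angle p <= pi.
Proof. by rewrite ge_min lexx. Qed.

Lemma dev_coord_chord b p q : M p -> M q -> 0 < dot p q ->
  (dev_coord b p - dev_coord b q) ^+ 2 <= sqr_chord alpha p q.
Proof.
move=> Mp Mq pq.
have [p0 _] := segre_veronese_lift Mp; have [q0 _] := segre_veronese_lift Mq.
have [v1 pE] := liftP Mp; have [w1 qE] := liftP Mq.
have l0 := enorm_gt0 p0; have m0 := enorm_gt0 q0.
set V := rank_one k (lift p) in pE; set W := rank_one k (lift q) in qE.
have pqE : dot p q = enorm p * enorm q * dot V W by rewrite {1}pE {1}qE dotZl dotZr mulrA.
have VW : 0 < dot V W by move: pq; rewrite pqE pmulr_rgt0// mulr_gt0.
apply: le_trans (polar_sin_lipschitz _ _ (enorm_ge0 _) (enorm_ge0 _)) _.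
rewrite lerD2l ler_pM2l ?mulr_gt0//.
rewrite (_ : _ / _ - 1 = (dot V W) ^- 2 - 1); last first.
  by rewrite pqE -!sqr_enorm; field; rewrite !gt_eqF.
rewrite opprD addrACA subrr addr0.
apply: le_trans (min_lipschitz _ _ _) _.
rewrite -mulrBr exprMn ler_wpM2l ?sqr_ge0//.
have h1 := angle_lipschitz hk u1 v1 w1 VW.
have h2 : angle k u (lift p) <= angle k u (lift q) + Num.sqrt ((dot V W) ^- 2 - 1).
  by have := angle_lipschitz hk u1 w1 v1; rewrite dotC => /(_ VW); rewrite dotC.
have X0 : 0 <= (dot V W) ^- 2 - 1.
  rewrite subr_ge0 invf_ge1 ?exprn_gt0// expr_le1//; last exact: ltW.
  have := dot_unit_bound _ _ (u := V) (v := W).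
  by rewrite -!sqr_enorm !enorm_rank_one// expr1n => /(_ erefl erefl)/andP[].
rewrite -(sqr_sqrtr X0) -[leLHS]real_normK ?num_real// lerXn2r ?nnegrE ?sqrtr_ge0//.
by rewrite ler_norml; apply/andP; split; move: h1 h2; rewrite -/V -/W; lra.
Qed.

Lemma length_ge_dev_coord b p q (s t : R) c : curve_from_to M p q s t c ->
  forall x y, s <= x -> x <= y -> y <= t ->
  ((dev_coord b (c y) - dev_coord b (c x))%:E <= curve_length (warped_metric alpha) x y c)%E.
Proof.
move=> [st cP cM _ _] x y sx xy yt.
apply: (@length_lower_bound _ _ alpha M (dev_coord b) s t c) => //.
- by move=> z /segre_veronese_lift[].
- exact: dev_coord_chord.
Qed.

(** No curve from [p] to [q] is shorter than the increment of a coordinate, so a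
   curve that is no longer than such an increment is minimizing. *)
Lemma calibrated_minimizing p q (s t : R) c (L b : R) : curve_from_to M p q s t c ->
  (curve_length (warped_metric alpha) s t c <= L%:E)%E ->
  L <= dev_coord b q - dev_coord b p ->
  curve_length (warped_metric alpha) s t c = intrinsic_dist M (warped_metric alpha) p q.
Proof.
move=> cpq cL Lb; apply/eqP; rewrite eq_le; apply/andP; split.
  apply: le_ereal_inf_tmp => _ [s' [t' [c' [c'pq ->]]]].
  apply: (le_trans cL).
  have [st' _ _ cs ct] := c'pq.
  have := length_ge_dev_coord b c'pq (lexx _) (ltW st') (lexx _).
  by apply: le_trans; rewrite cs ct lee_fin.
by apply: ereal_inf_lbound; exists s, t, c.
Qed.

End Lift.
End Development.

(** * Curves above a product of great circles *)

Section Paths.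
Context {R : realType} {d : nat} {n : 'I_d -> nat}.
Variable k : 'I_d -> nat.
Local Notation factors := (forall i : 'I_d, {ffun 'I_(n i) -> R}).
Local Notation E := {ffun multi_index n k -> R}.
Implicit Types (u v w : factors) (th : 'I_d -> R) (s t x : R) (r psi : R -> R).

Definition circles u w th s : factors :=
  fun i => cos (th i * s) *: u i + sin (th i * s) *: w i.

Definition spiral u w th r psi t : E := r t *: rank_one k (circles u w th (psi t)).

Section Speed.
Variables (u w : factors) (th : 'I_d -> R).
Hypothesis u1 : unit_factors u.
Hypothesis w1 : unit_factors w.
Hypothesis uw : forall i, dot (u i) (w i) = 0.

Lemma dot_circles s t i :
  dot (circles u w th s i) (circles u w th t i) = cos (th i * (s - t)).
Proof.
rewrite /circles !(dotDl, dotDr, dotZl, dotZr) (dotC (w i)) u1 w1 uw mulrBr cosB.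
ring.
Qed.

Lemma unit_circles s : unit_factors (circles u w th s).
Proof. by move=> i; rewrite dot_circles subrr mulr0 cos0. Qed.

Lemma smooth_spiral r psi : smooth r -> smooth psi ->
  forall J, smooth (fun t => spiral u w th r psi t J).
Proof.
move=> rs ps J.
rewrite (_ : (fun t => _) = (fun t => r t * \prod_i \prod_(l < k i)
   (cos (th i * psi t) * u i (J i l) + sin (th i * psi t) * w i (J i l)))).
  have ts i : smooth (fun t => th i * psi t) := smoothM (@smooth_cst R (th i)) ps.
  have term i l : smooth (fun t => cos (th i * psi t) * u i (J i l)
      + sin (th i * psi t) * w i (J i l)) :=
    smoothD (smoothM (smooth_comp (@smooth_cos R) (ts i)) (@smooth_cst R (u i (J i l))))
            (smoothM (smooth_comp (@smooth_sin R) (ts i)) (@smooth_cst R (w i (J i l)))).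
  exact (smoothM rs (smooth_prod (fun i => smooth_prod (term i)))).
apply/funext => t; rewrite !ffunE /GRing.scale/=; congr (_ * _).
by apply: eq_bigr => i _; apply: eq_bigr => l _; rewrite !ffunE.
Qed.

Lemma enorm_spiral r psi t : 0 <= r t -> enorm (spiral u w th r psi t) = r t.
Proof.
move=> r0; rewrite /enorm dotZl dotZr -sqr_enorm enorm_rank_one; last exact: unit_circles.
by rewrite expr1n mulr1 -expr2 sqrtr_sqr ger0_norm.
Qed.

Local Notation D2 := (\sum_i (k i)%:R * th i ^+ 2).

Lemma sqr_dot_circles s t :
  1 - D2 * (s - t) ^+ 2 <=
  dot (rank_one k (circles u w th s)) (rank_one k (circles u w th t)) ^+ 2.
Proof.
rewrite dot_rank_one -prodrXl.
apply: (@le_trans _ _ (\prod_i (1 - sin (th i * (s - t)) ^+ 2) ^+ k i)); last first.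
  rewrite le_eqVlt; apply/orP; left; apply/eqP/eq_bigr => i _.
  by rewrite dot_circles -cos2sin2 (exprAC _ (k i) 2).
apply: le_trans (bernoulli_prod_sub _ _) => [|i]; last first.
  by rewrite sqr_ge0/= sin2cos2 gerBl sqr_ge0.
rewrite lerD2l lerN2 mulr_suml; apply: ler_sum => i _.
by rewrite -mulrA -exprMn ler_wpM2l// sqr_sin_le.
Qed.

(** By [sqr_dot_circles] the tensors at two close parameters of [circles] make an
   angle of at most [sqrt D2] times the difference of the parameters, to first
   order; [chord_speed] turns this into a bound for the speed. *)
Lemma speed_spiral alpha r psi t : smooth r -> smooth psi -> 0 < r t ->
  speed alpha (spiral u w th r psi) t <=
  Num.sqrt ((r^`())%classic t ^+ 2 +
            (alpha * r t * (psi^`())%classic t) ^+ 2 * D2).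
Proof.
move=> rs ps rt0; set c := spiral u w th r psi.
apply: ler_wsqrtr.
have cs := smooth_spiral rs ps.
have ct0 : c t != 0.
  apply/eqP => e; have := enorm_spiral psi (ltW rt0); rewrite -/c e.
  rewrite enorm0 => e'.
  by move: rt0; rewrite -e' ltxx.
have dc J : derivable (fun t => c t J) t 1 by exact: smooth_derivable.
have rcont : r (h + t) @[h --> 0^'] --> r t by apply/cvg_shift/smooth_continuous.
have rq := derivable_quotient (@smooth_derivable _ r t rs).
have pq := derivable_quotient (@smooth_derivable _ psi t ps).
pose kap h := dot (rank_one k (circles u w th (psi t)))
  (rank_one k (circles u w th (psi (h + t)))).
have kapc : kap h @[h --> 0^'] --> (1 : R).
  pose S := spiral u w th (fun=> 1) psi.
  have Ss := smooth_spiral (@smooth_cst R 1) ps.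
  rewrite (_ : kap = (fun h => dot (S t) (S (h + t)))); last first.
    by apply/funext => h; rewrite /S /spiral !scale1r.
  have -> : 1 = dot (S t) (S t) by rewrite -sqr_enorm enorm_spiral ?expr1n.
  apply: cvg_dot => J; first exact: cvg_cst.
  have SJ : {for t, continuous (fun t => S t J)} by exact: (smooth_continuous (Ss J)).
  exact (cvg_shift SJ).
pose g h := (h^-1 * (r (h + t) - r t)) ^+ 2 +
  r t * r (h + t) * (alpha ^+ 2 * (D2 * (h^-1 * (psi (h + t) - psi t)) ^+ 2 / kap h ^+ 2)).
have gc : g h @[h --> 0^'] --> (r^`())%classic t ^+ 2 +
            r t * r t * (alpha ^+ 2 * (D2 * (psi^`())%classic t ^+ 2 / 1 ^+ 2)).
  apply: cvgD.
    by rewrite expr2 /=; under eq_fun do rewrite expr2; apply: cvgM; exact: rq.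
  apply: cvgM; first by apply: cvgM => //; exact: cvg_cst.
  apply: cvgM; first exact: cvg_cst.
  apply: cvgM.
    apply: cvgM; first exact: cvg_cst.
    by rewrite expr2; under eq_fun do rewrite expr2; apply: cvgM; exact: pq.
  apply: cvgV; first by rewrite expf_neq0// oner_neq0.
  by rewrite expr2; under eq_fun do rewrite expr2; exact: cvgM.
rewrite (_ : _ + _ = (r^`())%classic t ^+ 2 +
            r t * r t * (alpha ^+ 2 * (D2 * (psi^`())%classic t ^+ 2 / 1 ^+ 2))); last first.
  by field.
apply: (ler_cvg_to (@chord_speed _ _ alpha _ _ dc ct0) gc).
near=> h.
have h0 : h != 0 by near: h; exact: nbhs_dnbhs_neq.
have rh : 0 < r (h + t) by near: h; exact: (cvgr_gt (r t)).
have kap0 : 0 < kap h by near: h; exact: (cvgr_gt (1 : R)).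
rewrite /sqr_chord -!sqr_enorm !enorm_spiral ?(ltW rh) ?(ltW rt0)//.
rewrite /c /spiral dotZl dotZr -/(kap h) /g.
have := sqr_dot_circles (psi t) (psi (h + t)); rewrite -/(kap h).
set x := psi t - psi (h + t); set K := kap h in kap0 *.
rewrite lerBlDl -lerBlDr => Kx.
set A := r t; set B := r (h + t); set D := \sum_i _ in Kx *.
have A0 : 0 < A := rt0; have B0 : 0 < B := rh.
have xE : psi (h + t) - psi t = - x by rewrite opprB.
rewrite xE.
have chordK : A ^+ 2 * B ^+ 2 / (A * (B * K)) ^+ 2 - 1 <= D * x ^+ 2 / K ^+ 2.
  rewrite (_ : _ - 1 = (1 - K ^+ 2) / K ^+ 2); last by field; rewrite !gt_eqF.
  by rewrite ler_pM2r ?invr_gt0 ?exprn_gt0.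
rewrite [leRHS](_ : _ = (A - B) ^+ 2 / h ^+ 2
   + A * B * alpha ^+ 2 / h ^+ 2 * (D * x ^+ 2 / K ^+ 2)); last first.
  by field; rewrite h0 gt_eqF.
rewrite mulrDl lerD2l mulrA [leLHS]mulrAC ler_wpM2l//.
by rewrite divr_ge0 ?sqr_ge0// mulr_ge0 ?sqr_ge0// ltW// mulr_gt0.
Unshelve. all: by end_near. Qed.

End Speed.
End Paths.

Section Helix.
Context {R : realType} {d : nat} {n : 'I_d -> nat}.
Variable k : 'I_d -> nat.
Local Notation factors := (forall i : 'I_d, {ffun 'I_(n i) -> R}).
Local Notation E := {ffun multi_index n k -> R}.
Variables (u w : factors) (th : 'I_d -> R).
Hypothesis u1 : unit_factors u.
Hypothesis w1 : unit_factors w.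
Hypothesis uw : forall i, dot (u i) (w i) = 0.

Local Notation D2 := (\sum_i (k i)%:R * th i ^+ 2).

(** In polar coordinates of the plane, [(h * sqrt (1 + t ^ 2), atan t)] runs along
   a straight line at distance [h] of the origin, with speed [h]. The parameter [B]
   adjusts the angle in the product of spheres to the angle in the plane. *)
Definition helix (h A B : R) : R -> E :=
  spiral k u w th (fun t => h * Num.sqrt (1 + t * t)) (fun t => A + B * atan t).

Lemma oneDsqr_gt0 (t : R) : 0 < 1 + t * t.
Proof. by rewrite ltr_pwDl// -expr2 sqr_ge0. Qed.

(** The square of the speed is [h ^ 2 * (1 + 2 * q / (1 + t ^ 2))], with [2 * q + 1]
   the square of the ratio of the angular velocities of the curve and of the
   straight line; then [sqrt (1 + 2 * y) <= 1 + y] gives an integrable bound. *)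
Lemma helix_length alpha h A B (s t : R) : 0 < h -> s < t ->
  (curve_length (warped_metric alpha) s t (helix h A B) <=
  (h * (t - s) + h * (((alpha * B) ^+ 2 * D2 - 1) / 2) * (atan t - atan s))%:E)%E.
Proof.
move=> h0 st; set q := (_ - 1) / 2.
pose r (t : R) := h * Num.sqrt (1 + t * t).
pose psi (t : R) := A + B * atan t.
have ss : smooth (fun t : R => 1 + t * t) :=
  smoothD (@smooth_cst R 1) (smoothM (@smooth_id R) (@smooth_id R)).
have rs : smooth r := smoothM (@smooth_cst R h) (smooth_sqrt oneDsqr_gt0 ss).
have ps : smooth psi := smoothD (@smooth_cst R A) (smoothM (@smooth_cst R B) (@smooth_atan R)).
have r0 x : 0 < r x by rewrite mulr_gt0// sqrtr_gt0 oneDsqr_gt0.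
have did (x : R) : is_derive x 1 (fun t : R => t) 1 by exact: is_derive_id.
have dcst (a x : R) : is_derive x 1 (fun t : R => a) 0 by exact: is_derive_cst.
have dr x : (r^`())%classic x = h * (x / Num.sqrt (1 + x * x)).
  have s0 := oneDsqr_gt0 x.
  have d1 : is_derive x 1 (fun t : R => 1 + t * t) (x + x).
    have := is_deriveD (dcst 1 x) (is_deriveM (did x) (did x)).
    by rewrite add0r /GRing.scale/= mulr1; exact.
  have d2 := @is_derive1_comp R Num.sqrt (fun t => 1 + t * t) x _ _ (is_derive1_sqrt s0) d1.
  have d3 : is_derive x 1 r (h * (x / Num.sqrt (1 + x * x))).
    have e : (2 * Num.sqrt (1 + x * x))^-1 * (x + x) = x / Num.sqrt (1 + x * x).
      by field; rewrite sqrtr_eq0 -ltNge.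
    have := is_deriveM (dcst h x) d2.
    by rewrite /GRing.scale/= mulr0 addr0 e; exact.
  by rewrite derive1E derive_val.
have dpsi x : (psi^`())%classic x = B / (1 + x * x).
  have d3 : is_derive x 1 psi (B / (1 + x * x)).
    have := is_deriveD (dcst A x) (is_deriveM (dcst B x) (is_derive1_atan x)).
    by rewrite /GRing.scale/= mulr0 addr0 add0r expr2; exact.
  by rewrite derive1E derive_val.
pose F x := h * x + h * q * atan x.
have -> : h * (t - s) + h * q * (atan t - atan s) = F t - F s by rewrite /F; ring.
have cs := @smooth_spiral _ _ _ k u w th r psi rs ps.
apply: (@length_upper_bound _ _ alpha s t _ (fun x => h + h * q / (1 + x * x))) => //.
- move=> x _; apply/eqP => e.
  have := enorm_spiral k th u1 w1 uw psi (ltW (r0 x)).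
  rewrite -/(helix h A B) e enorm0 => e'.
  by have := r0 x; rewrite -e' ltxx.
- move=> x; have := is_deriveD (is_deriveM (dcst h x) (did x))
    (is_deriveM (dcst (h * q) x) (is_derive1_atan x)).
  by rewrite /GRing.scale/= !mulr0 !addr0 mulr1 expr2; exact.
- move=> x; apply: cvgD; first exact: cvg_cst.
  apply: cvgM; first exact: cvg_cst.
  apply: cvgV; first by rewrite gt_eqF// oneDsqr_gt0.
  by apply: cvgD; [exact: cvg_cst|apply: cvgM; exact: cvg_id].
move=> x _; apply: le_trans (speed_spiral k th u1 w1 uw alpha rs ps (r0 x)) _.
rewrite dr dpsi /r.
have s0 := oneDsqr_gt0 x.
have S2 : Num.sqrt (1 + x * x) ^+ 2 = 1 + x * x by rewrite sqr_sqrtr// ltW.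
have Sn0 : 0 < Num.sqrt (1 + x * x) by rewrite sqrtr_gt0.
have D0 : 0 <= D2 by apply: sumr_ge0 => i _; rewrite mulr_ge0 ?sqr_ge0.
have q2 : (alpha * B) ^+ 2 * D2 = 2 * q + 1 by rewrite /q; field.
have q1 : 0 <= 2 * q + 1 by rewrite -q2 mulr_ge0 ?sqr_ge0.
pose Y := (1 + x * x)^-1.
have Y0 : 0 < Y by rewrite invr_gt0.
have Y1 : Y <= 1 by rewrite invf_le1// lerDl -expr2 sqr_ge0.
have -> : h + h * q / (1 + x * x) = h * (1 + q * Y) by rewrite /Y; field; rewrite gt_eqF.
have b0 : 0 <= h * (1 + q * Y) by rewrite mulr_ge0 ?(ltW h0)//; nra.
rewrite -[leRHS](ger0_norm b0) -sqrtr_sqr ler_wsqrtr//.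
have -> : (h * (x / Num.sqrt (1 + x * x))) ^+ 2 +
   (alpha * (h * Num.sqrt (1 + x * x)) * (B / (1 + x * x))) ^+ 2 * D2 =
   h ^+ 2 * (1 + 2 * q * Y).
  rewrite !exprMn !exprVn S2.
  transitivity (h ^+ 2 * ((x ^+ 2 + (alpha * B) ^+ 2 * D2) * Y)).
    by rewrite /Y; field; rewrite gt_eqF.
  by rewrite q2 /Y; congr (_ * _); field; rewrite gt_eqF.
rewrite exprMn ler_wpM2l ?sqr_ge0//.
have := sqr_ge0 (q * Y); lra.
Qed.

End Helix.

(** * Minimizing curves between points at a small angle *)

Section Connectedness.
Context {R : realType} {d : nat} {n : 'I_d -> nat}.
Variable k : 'I_d -> nat.
Hypothesis hd : (1 <= d)%N.
Hypothesis hn : forall i, (2 <= n i)%N.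
Hypothesis hk : forall i, (1 <= k i)%N.
Local Notation factors := (forall i : 'I_d, {ffun 'I_(n i) -> R}).
Local Notation E := {ffun multi_index n k -> R}.
Local Notation M := (@segre_veronese R d n k).
Implicit Types (u v : factors) (p q : E).
Variable alpha : R.
Hypothesis alpha0 : 0 < alpha.

Local Notation K := (\sum_(i < d) k i)%N.

Lemma product_geodesic u v : unit_factors u -> unit_factors v ->
  exists w, [/\ unit_factors w, forall i, dot (u i) (w i) = 0,
    circles u w (fun i => acos (dot (u i) (v i))) 0 = u &
    circles u w (fun i => acos (dot (u i) (v i))) 1 = v].
Proof.
move=> u1 v1.
pose w : factors := fun i => projT1 (cid (great_circle (hn i) (u1 i) (v1 i))).
have wP i := projT2 (cid (great_circle (hn i) (u1 i) (v1 i))).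
exists w; split.
- by move=> i; case: (wP i).
- by move=> i; case: (wP i).
- apply: functional_extensionality_dep => i.
  by rewrite /circles mulr0 cos0 sin0 scale1r scale0r addr0.
- apply: functional_extensionality_dep => i.
  by rewrite /circles mulr1; case: (wP i).
Qed.

Lemma sum_k_gt0 : 0 < K%:R :> R.
Proof.
rewrite ltr0n (bigD1 (Ordinal hd))//=.
exact: leq_trans (hk _) (leq_addr _ _).
Qed.

Lemma prod_angle_le u v : unit_factors u -> unit_factors v ->
  prod_angle k u v <= pi * Num.sqrt K%:R.
Proof.
move=> u1 v1; rewrite -(@ler_pXn2r _ 2) ?nnegrE ?enorm_ge0 ?mulr_ge0 ?pi_ge0 ?sqrtr_ge0//.
rewrite sqr_prod_angle exprMn sqr_sqrtr ?ler0n// natr_sum mulr_sumr.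
apply: ler_sum => i _; rewrite mulrC ler_wpM2r//.
have b := dot_unit_bound (u1 i) (v1 i).
by rewrite lerXn2r ?nnegrE ?pi_ge0 ?acos_ge0 ?acos_lepi.
Qed.

Lemma lift_exists : exists lift : E -> factors, forall p, M p -> is_lift p (lift p).
Proof.
have h p : exists u, M p -> is_lift p u.
  have [/segre_veronese_lift[_ [u pu]]|Mp] := pselect (M p); first by exists u.
  by exists (fun i => 0) => /Mp.
by exists (fun p => projT1 (cid (h p))) => p; exact: projT2 (cid (h p)).
Qed.

Lemma spiral_curve u w th r psi (s t : R) (p q : E) : unit_factors u -> unit_factors w ->
  (forall i, dot (u i) (w i) = 0) -> smooth r -> smooth psi -> s < t ->
  {in `[s, t], forall x, 0 < r x} ->
  spiral k u w th r psi s = p -> spiral k u w th r psi t = q ->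
  curve_from_to M p q s t (spiral k u w th r psi).
Proof.
move=> u1 w1 uw rs ps st r0 sp tq; split; [exact: st| | |exact: sp|exact: tq].
  exact (smooth_piecewise st (@smooth_spiral _ _ _ k u w th r psi rs ps)).
by move=> x /r0 rx; apply: segre_veronese_rank_one => //; exact: unit_circles.
Qed.

Lemma helix_curve u w th h A B (s t : R) (p q : E) : unit_factors u -> unit_factors w ->
  (forall i, dot (u i) (w i) = 0) -> 0 < h -> s < t ->
  helix k u w th h A B s = p -> helix k u w th h A B t = q ->
  curve_from_to M p q s t (helix k u w th h A B).
Proof.
move=> u1 w1 uw h0 st.
have ss : smooth (fun t : R => 1 + t * t) :=
  smoothD (@smooth_cst R 1) (smoothM (@smooth_id R) (@smooth_id R)).
have rs : smooth (fun t => h * Num.sqrt (1 + t * t)) :=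
  smoothM (@smooth_cst R h) (smooth_sqrt (@oneDsqr_gt0 R) ss).
have ps : smooth (fun t => A + B * atan t) :=
  smoothD (@smooth_cst R A) (smoothM (@smooth_cst R B) (@smooth_atan R)).
apply: (spiral_curve u1 w1 uw rs ps st) => x _.
by rewrite mulr_gt0// sqrtr_gt0 oneDsqr_gt0.
Qed.

(** Points of the plane at distances [l] and [m] of the origin, seen from there at an
   angle [T < pi]: [h] is the distance of the origin to the line through them, and
   [b] and [b + T] are the angles measured from the foot of the perpendicular. *)
Lemma planar_segment (l m T : R) : 0 < l -> 0 < m -> 0 < T < pi ->
  exists h b : R, [/\ 0 < h, - (pi / 2) < b & b + T < pi / 2] /\
    h = l * cos b /\ h = m * cos (b + T).
Proof.
move=> l0 m0 /andP[T0 Tpi].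
have sT : 0 < sin T by rewrite sin_gt0_pi// T0.
pose b := atan ((m * cos T - l) / (m * sin T)).
have cb : 0 < cos b by rewrite cos_gt0_pihalf// atan_gtNpi2 atan_ltpi2.
have tb : sin b = (m * cos T - l) / (m * sin T) * cos b.
  have := atanK ((m * cos T - l) / (m * sin T)); rewrite -/b /tan => <-.
  by rewrite divfK// gt_eqF.
have mE : m * cos (b + T) = l * cos b.
  by rewrite cosD tb; field; rewrite !gt_eqF.
have b1 : - (pi / 2) < b := atan_gtNpi2 _.
have b2 : b < pi / 2 := atan_ltpi2 _.
exists (l * cos b), b; split; last by rewrite mE.
split => //; first exact: mulr_gt0.
rewrite ltNge; apply/negP => h.
have : 0 < cos (b + T) by rewrite -(pmulr_rgt0 _ m0) mE mulr_gt0.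
have -> : b + T = (b + T - pi / 2) + pi / 2 by ring.
rewrite cosDpihalf oppr_gt0 ltNge sin_ge0_pi//.
by rewrite subr_ge0 h/= lerBlDr; lra.
Qed.

Lemma segment_gt0 (l m x : R) : 0 < l -> 0 < m -> 0 <= x <= 1 -> 0 < l + x * (m - l).
Proof. by move=> l0 m0 /andP[x0 x1]; nra. Qed.

(** The segment between the unrolled points is followed by a [helix], with [D] the
   angle of the endpoints; for [D = 0] it lies on a ray. *)
Lemma connected_of_small : alpha < 1 / Num.sqrt K%:R ->
  geodesically_connected M (warped_metric alpha).
Proof.
move=> small p q Mp Mq.
have sK : 0 < Num.sqrt K%:R :> R by rewrite sqrtr_gt0 sum_k_gt0.
have [lift liftP] := lift_exists.
have [u1 pE] := liftP _ Mp; have [v1 qE] := liftP _ Mq.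
have [p0 _] := segre_veronese_lift Mp; have [q0 _] := segre_veronese_lift Mq.
have l0 := enorm_gt0 p0; have m0 := enorm_gt0 q0.
set u := lift p in u1 pE; set l := enorm p in pE l0; set m := enorm q in qE m0.
have [s1 _] := best_flipP k u (lift q).
pose v := flip (best_flip k u (lift q)) (lift q).
have v1' : unit_factors v by exact: unit_flip.
have qE' : q = m *: rank_one k v by rewrite rank_one_flip s1 scale1r.
pose th i := acos (dot (u i) (v i)).
have [w [w1 uw w0 wv]] := product_geodesic u1 v1'.
rewrite -/th in w0 wv.
pose D := prod_angle k u v.
have D0 : 0 <= D := enorm_ge0 _.
have D2 : \sum_i (k i)%:R * th i ^+ 2 = D ^+ 2 by rewrite sqr_prod_angle.
have aD : alpha * D < pi.
  apply: (@le_lt_trans _ _ (alpha * (pi * Num.sqrt K%:R))).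
    by rewrite ler_pM2l// prod_angle_le.
  by rewrite mulrCA gtr_pMr ?pi_gt0// -ltr_pdivlMr.
have aq : dev_angle alpha lift u q = alpha * D.
  by rewrite /dev_angle -/D min_r// ltW.
have ap : dev_angle alpha lift u p = 0.
  by rewrite /dev_angle angle_refl// mulr0 min_r// pi_ge0.
have [De|Dn0] := eqVneq D 0.
  pose r (t : R) := l + t * (m - l).
  have rs : smooth r :=
    smoothD (@smooth_cst R l) (smoothM (@smooth_id R) (@smooth_cst R (m - l))).
  have cpq : curve_from_to M p q 0 1 (spiral k u w th r id).
    apply: (spiral_curve u1 w1 uw rs (@smooth_id R) ltr01).
    - by move=> x; rewrite in_itv/= => x01; exact: segment_gt0.
    - by rewrite /spiral w0 /r mul0r addr0.
    - by rewrite /spiral wv /r mul1r addrC subrK.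
  have [b bP] : exists b, `|m - l| <= dev_coord alpha lift u b q - dev_coord alpha lift u b p.
    have pol b : dev_coord alpha lift u b q - dev_coord alpha lift u b p = (m - l) * sin b.
      by rewrite /dev_coord ap aq De mulr0 add0r mulrBl.
    have [lm|ml] := leP l m.
      by exists (pi / 2); rewrite pol sin_pihalf mulr1 ger0_norm// subr_ge0.
    by exists (- (pi / 2)); rewrite pol sinN sin_pihalf mulrN1 ltr0_norm ?subr_lt0.
  exists 0, 1, (spiral k u w th r id); split=> //.
  apply: (calibrated_minimizing hk liftP u1 cpq _ bP).
  have cs := @smooth_spiral _ _ _ k u w th r id rs (@smooth_id R).
  have [_ _ cM _ _] := cpq.
  have did (x : R) : is_derive x 1 (fun t : R => t) 1 by exact: is_derive_id.
  have dcst (a x : R) : is_derive x 1 (fun t : R => a) 0 by exact: is_derive_cst.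
  have dr x : (r^`())%classic x = m - l.
    have := is_deriveD (dcst l x) (is_deriveM (did x) (dcst (m - l) x)).
    rewrite add0r /GRing.scale/= mulr0 add0r mulr1 => dr.
    by rewrite derive1E (@derive_val _ _ _ _ _ _ _ dr).
  have := @length_upper_bound _ _ alpha 0 1 _
    (fun=> `|m - l|) (fun t => `|m - l| * t) ltr01 cs.
  rewrite mulr1 mulr0 subr0; apply.
  - by move=> x /cM /segre_veronese_lift[].
  - move=> x; have := is_deriveM (dcst `|m - l| x) (did x).
    by rewrite /GRing.scale/= mulr0 addr0 mulr1; exact.
  - by move=> x; exact: cvg_cst.
  - move=> x x01; apply: le_trans (speed_spiral k th u1 w1 uw alpha rs (@smooth_id R) _) _.
      by move: x01; rewrite in_itv/=; exact: segment_gt0.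
    by rewrite D2 De expr0n mulr0 addr0 dr sqrtr_sqr.
have {Dn0}D0 : 0 < D by rewrite lt_def Dn0.
have T0 : 0 < alpha * D < pi by rewrite mulr_gt0.
have [h [b [[h0 b1 b2] [hl hm]]]] := planar_segment l0 m0 T0.
set T := alpha * D in T0 b2 hm.
have hyp (x c : R) : - (pi / 2) < x < pi / 2 -> h = c * cos x ->
    h * Num.sqrt (1 + tan x * tan x) = c.
  move=> xpi hc.
  have cx : 0 < cos x by exact: cos_gt0_pihalf.
  have := cos_atan (tan x); rewrite tanK ?in_itv// -expr2 => e.
  by rewrite hc e mulfVK// gt_eqF// sqrtr_gt0 ltr_pwDl// sqr_ge0.
have T1 : 0 < T by case/andP: T0.
have bpi : - (pi / 2) < b < pi / 2 by rewrite b1 (lt_trans _ b2)// ltrDl.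
have bTpi : - (pi / 2) < b + T < pi / 2 by rewrite b2 andbT (lt_trans b1)// ltrDl.
have st : tan b < tan (b + T) by rewrite ltr_tan ?in_itv// ltrDl.
have cpq : curve_from_to M p q (tan b) (tan (b + T)) (helix k u w th h (- b / T) T^-1).
  apply: helix_curve => //; rewrite /helix /spiral.
    by rewrite (hyp b l) // tanK ?in_itv// mulrC -mulrDr addNr mulr0 w0.
  rewrite (hyp (b + T) m) // tanK ?in_itv//.
  rewrite (_ : - b / T + T^-1 * (b + T) = 1) ?wv//.
  by field; rewrite gt_eqF.
exists (tan b), (tan (b + T)), (helix k u w th h (- b / T) T^-1); split=> //.
apply: (calibrated_minimizing (L := h * (tan (b + T) - tan b)) (b := b) hk liftP u1 cpq).
  apply: le_trans (helix_length k th u1 w1 uw alpha _ _ h0 st) _.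
  rewrite D2 lee_fin (_ : (alpha / T) ^+ 2 * D ^+ 2 = 1).
    by rewrite subrr !mul0r mulr0 mul0r addr0.
  by rewrite -exprMn mulrAC -/T divff ?expr1n// gt_eqF.
have e1 : h * tan (b + T) = m * sin (b + T).
  by rewrite hm /tan -mulrA [cos _ * _]mulrC divfK// gt_eqF// cos_gt0_pihalf.
have e2 : h * tan b = l * sin b.
  by rewrite hl /tan -mulrA [cos _ * _]mulrC divfK// gt_eqF// cos_gt0_pihalf.
by rewrite /dev_coord ap aq -/T -/l -/m add0r (addrC T) mulrBr e1 e2.
Qed.

(** * Points orthogonal in every factor *)

Section Orthogonal.
Variables (u v : factors).
Hypothesis u1 : unit_factors u.
Hypothesis v1 : unit_factors v.
Hypothesis uv : forall i, dot (u i) (v i) = 0.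
Hypothesis large : 2 / Num.sqrt K%:R <= alpha.
Local Notation p := (rank_one k u).
Local Notation q := (rank_one k v).

(** Changes of signs preserve orthogonality. *)
Lemma orthogonal_angle s : prod_angle k u (flip s v) = pi / 2 * Num.sqrt K%:R.
Proof.
apply: (@pexpIrn _ 2); rewrite ?nnegrE ?enorm_ge0 ?mulr_ge0 ?divr_ge0 ?pi_ge0 ?sqrtr_ge0//.
rewrite sqr_prod_angle exprMn sqr_sqrtr ?ler0n// natr_sum mulr_sumr.
by apply: eq_bigr => i _; rewrite dotZr uv mulr0 acos0 mulrC.
Qed.

(** Choosing the lifts of the two endpoints to be [u] and [v] makes their angle
   computable; it is [pi] because of the truncation. *)
Lemma far_ends : exists lift : E -> factors,
  [/\ forall p, M p -> is_lift p (lift p),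
    dev_angle alpha lift u p = 0 & dev_angle alpha lift u q = pi].
Proof.
have [lift0 lift0P] := lift_exists.
have sK : 0 < Num.sqrt K%:R :> R by rewrite sqrtr_gt0 sum_k_gt0.
have pq : q != p.
  apply/eqP => e; have := enorm_rank_one k u1.
  rewrite /enorm -{2}e dot_rank_one (bigD1 (Ordinal hd))//= uv expr0n eqn0Ngt hk mul0r sqrtr0.
  by move=> /eqP; rewrite eq_sym oner_eq0.
have lp w : unit_factors w -> is_lift (rank_one k w) w.
  by move=> w1; split=> //; rewrite enorm_rank_one// scale1r.
exists (fun x => if x == p then u else if x == q then v else lift0 x); split.
- move=> x Mx; case: eqP => [->|_]; first exact: lp.
  by case: eqP => [->|_]; [exact: lp|exact: lift0P].
- by rewrite /dev_angle eqxx angle_refl// mulr0 min_r// pi_ge0.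
rewrite /dev_angle (negbTE pq) eqxx min_l// /angle orthogonal_angle.
move: large; rewrite ler_pdivrMr// => h.
rewrite mulrCA; have := pi_gt0 R; nra.
Qed.

(** The unrolled points are opposite unit vectors. The curve meets the axis
   orthogonal to them at a distance [nu > 0] of the origin, and both its parts are
   at least as long as a segment, i.e. as [sqrt (1 + nu ^ 2) > 1]. *)
Lemma far_length (s t : R) c : curve_from_to M p q s t c ->
  (2%:E < curve_length (warped_metric alpha) s t c)%E.
Proof.
move=> cpq; have [lift [liftP ap aq]] := far_ends.
have [st cP cM cs ct] := cpq.
have np : enorm p = 1 by exact: enorm_rank_one.
have nq : enorm q = 1 by exact: enorm_rank_one.
have gc : {within `[s, t], continuous (dev_coord alpha lift u (pi / 2) \o c)}.
  apply: (@F_continuous _ _ alpha M) => //; last exact: dev_coord_chord.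
  by move=> z /segre_veronese_lift[].
have [|x xst] := IVT (v := 0) (ltW st) gc.
  rewrite /= cs ct /dev_coord ap aq np nq !mul1r add0r sinDpihalf cospi sin_pihalf.
  by rewrite ge_min le_max lerN10 ler01 orbT.
have /segre_veronese_lift[cx0 _] := cM x xst.
have nu0 := enorm_gt0 cx0; set nu := enorm (c x) in nu0.
rewrite /= /dev_coord -/nu sinDpihalf => /eqP; rewrite mulf_eq0 (gt_eqF nu0)/= => /eqP cosx.
set y := dev_angle alpha lift u (c x) in cosx.
have siny : sin y = 1.
  have s0 : 0 <= sin y by rewrite sin_ge0_pi// dev_angle_ge0//= dev_angle_lepi.
  apply: (@pexpIrn _ 2); rewrite ?nnegrE//.
  by rewrite sin2cos2 cosx expr0n subr0 expr1n.
move: xst; rewrite in_itv/= => /andP[sx xt].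
(* The coordinates with parameters [- g] and [g - pi] are along the segments from
   [p] to the crossing point and from there to [q]. *)
pose g := atan nu^-1.
have cg : 0 < cos g by rewrite cos_gt0_pihalf// atan_gtNpi2 atan_ltpi2.
have sg : nu * sin g = cos g.
  have := atanK nu^-1; rewrite -/g /tan => e.
  by rewrite -[sin g](@divfK _ (cos g)) ?gt_eqF// e mulrA divff ?mul1r// gt_eqF.
have sg0 : 0 < sin g by rewrite -(pmulr_rgt0 _ nu0) sg.
have sg1 : sin g < 1.
  have := cos2Dsin2 g; have := exprn_gt0 2 cg; move: (sin_le1 g); nra.
have val : 1 < nu * cos g + sin g.
  have e1 : sin g * (nu * cos g + sin g) = 1.
    by rewrite mulrDr mulrA (mulrC _ nu) sg -!expr2 cos2Dsin2.
  by rewrite -(ltr_pM2l sg0) e1 mulr1.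
rewrite (@length_split _ _ alpha M s t c _ cP cM s x t (lexx s) _ (lexx t)) ?sx//; last first.
  by move=> z /segre_veronese_lift[].
have h1 := length_ge_dev_coord hk alpha liftP u1 (- g) cpq (lexx _) sx xt.
have h2 := length_ge_dev_coord hk alpha liftP u1 (g - pi) cpq sx xt (lexx _).
apply: (@lt_le_trans _ _ ((nu * cos g + sin g)%:E + (nu * cos g + sin g)%:E)%E).
  rewrite -EFinD lte_fin; lra.
apply: leeD.
  move: h1; rewrite cs /dev_coord ap np -/nu -/y add0r mul1r sinN opprK.
  by rewrite sinD siny cosx cosN mul1r mul0r addr0.
move: h2; rewrite ct /dev_coord aq nq -/nu -/y mul1r [pi + _]addrC subrK.
rewrite sinD siny cosx mul0r addr0 mul1r.
by rewrite -[g - pi]opprB cosN cosB cospi sinpi mul0r addr0 mulN1r mulrN opprK addrC.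
Qed.

(** For [T] large, the helix from [- T] to [T] comes close to the origin; there,
   turning by the excess of [alpha * phi] over the planar angle costs little: the
   length is at most [2 + C / T]. *)
Lemma far_dist e : 0 < e -> (intrinsic_dist M (warped_metric alpha) p q <= (2 + e)%:E)%E.
Proof.
move=> e0.
pose th i := acos (dot (u i) (v i)).
have [w [w1 uw w0 wv]] := product_geodesic u1 v1.
rewrite -/th in w0 wv.
set D := \sum_i (k i)%:R * th i ^+ 2.
have D0 : 0 <= D by apply: sumr_ge0 => i _; rewrite mulr_ge0 ?sqr_ge0.
pose C := alpha ^+ 2 * D / pi.
have C0 : 0 <= C by rewrite mulr_ge0 ?invr_ge0 ?pi_ge0// mulr_ge0// sqr_ge0.
pose T := 1 + C / e.
have T1 : 1 <= T by rewrite lerDl divr_ge0// ltW.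
have T0 : 0 < T := lt_le_trans ltr01 T1.
pose S := Num.sqrt (1 + T * T).
have S0 : 0 < S by rewrite sqrtr_gt0 oneDsqr_gt0.
have ST : T <= S by apply: ler_sqrt_of_sqr; rewrite expr2 lerDr.
have aT : pi / 4 <= atan T by rewrite -atan1 le_atan.
have aT0 : 0 < atan T by apply: lt_le_trans aT; rewrite divr_gt0 ?pi_gt0.
have NTT : - T < T by lra.
have cpq : curve_from_to M p q (- T) T (helix k u w th S^-1 2^-1 (2 * atan T)^-1).
  apply: helix_curve; rewrite ?invr_gt0//; rewrite /helix /spiral.
    rewrite mulrNN -/S mulVf ?gt_eqF// scale1r atanN.
    by rewrite (_ : 2^-1 + _ = 0) ?w0//; field; rewrite gt_eqF.
  rewrite -/S mulVf ?gt_eqF// scale1r.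
  by rewrite (_ : 2^-1 + _ = 1) ?wv//; field; rewrite gt_eqF.
apply: le_trans (_ : (curve_length (warped_metric alpha) (- T) T
    (helix k u w th S^-1 2^-1 (2 * atan T)^-1) <= _)%E).
  by apply: ereal_inf_lbound; exists (- T), T, (helix k u w th S^-1 2^-1 (2 * atan T)^-1).
have Si0 : 0 < S^-1 by rewrite invr_gt0.
apply: le_trans (helix_length k th u1 w1 uw alpha _ _ Si0 NTT) _.
rewrite lee_fin -/D atanN !opprK.
have h1 : S^-1 * (T + T) <= 2 by rewrite mulrC ler_pdivrMr// mulrDl mul1r lerD.
apply: lerD => //.
apply: (@le_trans _ _ (S^-1 * C)); last first.
  rewrite mulrC ler_pdivrMr//; apply: (@le_trans _ _ (e * T)); last by rewrite ler_pM2l.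
  by rewrite /T mulrDr mulr1 mulrCA divff ?gt_eqF// mulr1 lerDr ltW.
rewrite -mulrA ler_pM2l//.
apply: (@le_trans _ _ (alpha ^+ 2 * D / (4 * atan T))).
  rewrite exprMn exprVn.
  rewrite [leLHS](_ : _ = alpha ^+ 2 * D / (4 * atan T) - atan T); last first.
    by field; rewrite gt_eqF.
  by rewrite gerBl ltW.
apply: ler_wpM2l; first by rewrite mulr_ge0 ?sqr_ge0.
by rewrite lef_pV2 ?posrE ?pi_gt0 ?mulr_gt0// mulrC -ler_pdivrMr.
Qed.

End Orthogonal.

Lemma not_connected_of_large : 2 / Num.sqrt K%:R <= alpha ->
  ~ geodesically_connected M (warped_metric alpha).
Proof.
move=> large conn.
(* The first two vectors of the standard basis exist since [2 <= n i]. *)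
pose e (j : nat) (i : 'I_d) : {ffun 'I_(n i) -> R} :=
  [ffun l : 'I_(n i) => (l == j :> nat)%:R].
have dot_e i j j' : (j < n i)%N -> dot (e j i) (e j' i) = (j == j')%:R.
  move=> jn; rewrite /dot (bigD1 (Ordinal jn))//= !ffunE eqxx mul1r big1 ?addr0// => l lj.
  rewrite !ffunE (_ : (l == j :> nat) = false) ?mul0r//.
  by apply: contraNF lj => /eqP lj; apply/eqP/val_inj.
have u1 : unit_factors (e 0%N) by move=> i; rewrite dot_e// (leq_trans _ (hn i)).
have v1 : unit_factors (e 1%N) by move=> i; rewrite dot_e.
have uv i : dot (e 0%N i) (e 1%N i) = 0 by rewrite dot_e// (leq_trans _ (hn i)).
have MP w : unit_factors w -> M (rank_one k w).
  by move=> w1; rewrite -[rank_one k w]scale1r; exact: segre_veronese_rank_one.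
have [a [b [c [cpq clen]]]] := conn _ _ (MP _ u1) (MP _ v1).
have := far_length u1 v1 uv large cpq; rewrite clen ltNge => /negP; apply.
by apply/lee_addgt0Pr => eps eps0; rewrite -EFinD; exact: far_dist.
Qed.

End Connectedness.

Unset Implicit Arguments.

Theorem proposition4p14 (R : realType) (d : nat) (n k : 'I_d -> nat)
    (alpha : R) (hd : (1 <= d)%N) (hn : forall i : 'I_d, (2 <= n i)%N)
    (hk : forall i : 'I_d, (1 <= k i)%N) (halpha : 0 < alpha) :
  (alpha < 1 / Num.sqrt (\sum_(i < d) k i)%:R ->
    geodesically_connected (@segre_veronese R d n k) (warped_metric alpha)) /\
  (2 / Num.sqrt (\sum_(i < d) k i)%:R <= alpha ->
    ~ geodesically_connected (@segre_veronese R d n k) (warped_metric alpha)).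
Proof.
by split; [exact: connected_of_small|exact: not_connected_of_large].
Qed.
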